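(* Every pants-like $\mathrm{COL}_3$ subgroup of $\mathrm{Homeo}^+(S^1)$ is a discrete subgroup of $\mathrm{Homeo}^+(S^1)$ with the compact open topology.
   Context: $S^1$ is the unit circle, oriented counterclockwise. For distinct $u,v\in S^1$, $(u,v)_{S^1}$ is the set of $p$ such that $(u,p,v)$ is counterclockwise ordered (a nondegenerate open interval); the dual of $I=(u,v)_{S^1}$ is $I^*=(v,u)_{S^1}$; $\{I,I^*\}$ lies on $J$ if $I\subseteq J$ or $I^*\subseteq J$. A lamination system is a nonempty family $\mathcal{L}$ of nondegenerate open intervals such that: (1) $I\in\mathcal{L}\Rightarrow I^*\in\mathcal{L}$; (2) for all $I,J\in\mathcal{L}$, $\{I,I^*\}$ lies on $J$ or on $J^*$; (3) if $I_n\in\mathcal{L}$, $I_n\subseteq I_{n+1}$ for all $n$, and $\bigcup_n I_n$ is a nondegenerate open interval, then $\bigcup_n I_n\in\mathcal{L}$. A leaf is $\ell(I)=\{I,I^*\}$ with $I\in\mathcal{L}$. A gap is a subset $\mathscr{G}\subseteq\mathcal{L}$ of pairwise disjoint intervals such that for each $I\in\mathcal{L}$ there is $J\in\mathscr{G}$ on which $\ell(I)$ lies; $v(\mathscr{G})=S^1\setminus\bigcup_{I\in\mathscr{G}}I$. $\mathcal{L}$ is very full if $v(\mathscr{G})$ is finite for every gap. $E(\mathcal{L})=\bigcup_{I\in\mathcal{L}}v(\ell(I))$. For $G<\mathrm{Homeo}^+(S^1)$, $\mathcal{L}$ is $G$-invariant if $g(I)\in\mathcal{L}$ for all $g\in G$,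 $I\in\mathcal{L}$. Two lamination systems are transverse if disjoint as sets. A nontrivial element of $\mathrm{Homeo}^+(S^1)$ is parabolic if it has exactly one fixed point; a cusp point of $G$ is a point fixed by some parabolic element of $G$. A collection $\{\mathcal{L}_\alpha\}$ of $G$-invariant very full lamination systems is pants-like if its members are pairwise transverse and, for $\alpha\ne\beta$, every point of $E(\mathcal{L}_\alpha)\cap E(\mathcal{L}_\beta)$ is a cusp point of $G$. $G$ is pants-like $\mathrm{COL}_n$ if it admits a pants-like collection with $n$ elements. *)

(* Defs.v *)
From HB Require Import structures.
From mathcomp Require Import all_boot all_order all_algebra ring lra.
From mathcomp Require Import all_classical all_reals all_analysis.

Set Implicit Arguments.
Unset Strict Implicit.
Unset Printing Implicit Defensive.

Import Order.TTheory GRing.Theory Num.Theory.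
Import numFieldNormedType.Exports.

Local Open Scope classical_set_scope.
Local Open Scope ring_scope.

Definition unit_circle (R : realType) : set (R * R) :=
  [set p | p.1 ^+ 2 + p.2 ^+ 2 = 1].

Arguments unit_circle : clear implicits.

Definition S1 (R : realType) : topologicalType := set_type (unit_circle R).

Section Orientation.
Context {R : realType}.
Implicit Types u p v : S1 R.

Definition xco p : R := (set_val p).1.
Definition yco p : R := (set_val p).2.

(* Positivity of the determinant of (p - u, v - u), that is, the plane triangle
   with vertices u, p, v is nondegenerate and positively oriented; see
   [ccw_angle] for the description by angles. *)
Definition ccw u p v : Prop :=
  0 < (xco p - xco u) * (yco v - yco u) - (yco p - yco u) * (xco v - xco u).

Definition arc u v : set (S1 R) := [set p | ccw u p v].

Definition nondegenerate_open_interval (I : set (S1 R)) : Prop :=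
  exists u v, u <> v /\ I = arc u v.

(* The endpoints u, v are determined by I, see [dual_arc]. *)
Definition dual (I : set (S1 R)) : set (S1 R) :=
  [set p | exists u v, [/\ u <> v, I = arc u v & arc v u p]].

Lemma S1_eq p v : xco p = xco v -> yco p = yco v -> p = v.
Proof.
move=> h1 h2; apply: val_inj; rewrite /xco /yco set_valE in h1 h2.
by move: h1 h2; case: (\val p) => a b; case: (\val v) => c d /= -> ->.
Qed.

Lemma S1_norm p : xco p ^+ 2 + yco p ^+ 2 = 1.
Proof. by have := set_valP p. Qed.

Lemma ccw_rot u p v : ccw u p v -> ccw p v u.
Proof. rewrite /ccw => h; lra. Qed.

Lemma ccw_asym u p v : ccw u p v -> ~ ccw u v p.
Proof. rewrite /ccw => h h'; lra. Qed.

(* coordinates of p - u in the orthogonal frame (- u, rotated - u) *)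
Let sco u p : R := 1 - (xco u * xco p + yco u * yco p).
Let tco u p : R := yco u * xco p - xco u * yco p.

Let sco_tco u p : sco u p ^+ 2 + tco u p ^+ 2 = 2 * sco u p.
Proof.
have hu := S1_norm u; have hp := S1_norm p; rewrite /sco /tco.
transitivity (1 - 2 * (xco u * xco p + yco u * yco p)
  + (xco u ^+ 2 + yco u ^+ 2) * (xco p ^+ 2 + yco p ^+ 2)); first by ring.
rewrite hu hp; ring.
Qed.

Let ccwE u p v : ccw u p v <-> 0 < sco u p * tco u v - tco u p * sco u v.
Proof.
rewrite /ccw; set A := (X in 0 < X <-> _); set B := (X in _ <-> 0 < X).
suff -> : A = B by [].
have hu := S1_norm u; rewrite /A /B /sco /tco.
set a := xco u in hu *; set b := yco u in hu *.
set c := xco p; set d := yco p; set e := xco v; set f := yco v.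
transitivity ((c * f - d * e) * (a ^+ 2 + b ^+ 2) - c * b - a * f + d * a + b * e).
  by rewrite hu; ring.
ring.
Qed.

Let sco_gt0 u p : u <> p -> 0 < sco u p.
Proof.
move=> up; have := sco_tco u p; case: (ltgtP 0 (sco u p)) => // [s0|s0].
  have := sqr_ge0 (sco u p); have := sqr_ge0 (tco u p); lra.
rewrite -s0 expr0n mulr0 /= add0r => /eqP; rewrite sqrf_eq0 => /eqP t0.
exfalso; apply: up; have hu := S1_norm u; have hp := S1_norm p.
move: s0 t0; rewrite /sco /tco => s0 t0.
have : (xco u - xco p) ^+ 2 + (yco u - yco p) ^+ 2 = 0 by lra.
move/eqP; rewrite paddr_eq0 ?sqr_ge0 // !sqrf_eq0 !subr_eq0.
by move=> /andP[/eqP h1 /eqP h2]; exact: S1_eq.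
Qed.

Lemma ccw_neq u p v : ccw u p v -> [/\ u <> p, p <> v & u <> v].
Proof. by rewrite /ccw => h; split=> e; move: h; rewrite e; lra. Qed.

Lemma ccw_trans u p q v : ccw u p q -> ccw u q v -> ccw u p v.
Proof.
move=> h1 h2; have [/sco_gt0 sp _ /sco_gt0 sq] := ccw_neq h1.
have [_ _ /sco_gt0 sv] := ccw_neq h2.
move: h1 h2; rewrite !ccwE => h1 h2.
rewrite -(pmulr_rgt0 _ sq).
have -> : sco u q * (sco u p * tco u v - tco u p * sco u v) =
  sco u v * (sco u p * tco u q - tco u p * sco u q) +
  sco u p * (sco u q * tco u v - tco u q * sco u v) by ring.
by rewrite addr_gt0 // mulr_gt0.
Qed.

Lemma ccw_total u p v : u <> p -> p <> v -> u <> v -> ccw u p v \/ ccw u v p.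
Proof.
move=> up pv uv; have sp := sco_gt0 up; have sv := sco_gt0 uv.
case: (ltgtP 0 (sco u p * tco u v - tco u p * sco u v)) => h.
- by left; rewrite ccwE.
- by right; rewrite ccwE; lra.
exfalso; apply: pv.
have hp := sco_tco u p; have hv := sco_tco u v.
have es : sco u p = sco u v.
  apply: (mulfI (lt0r_neq0 (mulr_gt0 sp sv))).
  have h2 : (sco u p * tco u v) ^+ 2 = (tco u p * sco u v) ^+ 2.
    by congr (_ ^+ 2); lra.
  have : sco u p ^+ 2 * (sco u v ^+ 2 + tco u v ^+ 2) =
         sco u v ^+ 2 * (sco u p ^+ 2 + tco u p ^+ 2).
    by rewrite !mulrDr -!exprMn h2; ring.
  rewrite hp hv => h3; lra.
have et : tco u p = tco u v.
  by apply: (mulfI (lt0r_neq0 sp)); rewrite es in h *; lra.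
have hu := S1_norm u.
have e1 w : xco w = xco u * (1 - sco u w) + yco u * tco u w.
  rewrite /sco /tco; transitivity (xco w * (xco u ^+ 2 + yco u ^+ 2)); last ring.
  by rewrite hu mulr1.
have e2 w : yco w = yco u * (1 - sco u w) - xco u * tco u w.
  rewrite /sco /tco; transitivity (yco w * (xco u ^+ 2 + yco u ^+ 2)); last ring.
  by rewrite hu mulr1.
by apply: S1_eq; rewrite 1?(e1 p) 1?(e1 v) 1?(e2 p) 1?(e2 v) es et.
Qed.

Lemma cis_subproof (t : R) : (cos t, sin t) \in unit_circle R.
Proof. by apply/mem_set; rewrite /unit_circle /= cos2Dsin2. Qed.

Definition cis (t : R) : S1 R :=
  exist (fun z => z \in unit_circle R) (cos t, sin t) (cis_subproof t).

Lemma ccw_angle (a s t : R) : 0 < s -> s < t -> t < 2 * pi ->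
  ccw (cis a) (cis (a + s)) (cis (a + t)).
Proof.
move=> s0 st t2; rewrite ccwE.
have hs x : sco (cis a) (cis (a + x)) = 1 - cos x.
  rewrite /sco /xco /yco !set_valE /= cosD sinD.
  transitivity (1 - cos x * (cos a ^+ 2 + sin a ^+ 2)); first by ring.
  by rewrite cos2Dsin2 mulr1.
have ht x : tco (cis a) (cis (a + x)) = - sin x.
  rewrite /tco /xco /yco !set_valE /= cosD sinD.
  transitivity (- sin x * (cos a ^+ 2 + sin a ^+ 2)); first by ring.
  by rewrite cos2Dsin2 mulr1.
rewrite !hs !ht.
have half (x : R) : 1 - cos x = 2 * sin (x / 2) ^+ 2.
  by rewrite [in cos x](splitr x) cosD; have := cos2Dsin2 (x / 2); lra.
have dbl (x : R) : sin x = 2 * sin (x / 2) * cos (x / 2).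
  by rewrite [in LHS](splitr x) sinD; ring.
have -> : (1 - cos s) * - sin t - - sin s * (1 - cos t) =
   4 * sin (s / 2) * sin (t / 2) * sin ((t - s) / 2).
  by rewrite [(t - s) / 2]mulrBl sinB !half (dbl s) (dbl t); ring.
by rewrite !mulr_gt0 ?sin_gt0_pi //; lra.
Qed.

Lemma arc_nonempty u v : u <> v -> arc u v !=set0.
Proof.
move=> uv; have s0 := sco_gt0 uv; have hst := sco_tco u v.
have hu := S1_norm u; have hv := S1_norm v.
set a := xco u in hu; set b := yco u in hu.
set c := xco v in hv; set d := yco v in hv.
pose n := Num.sqrt (2 * sco u v).
have n2 : n ^+ 2 = 2 * sco u v by rewrite sqr_sqrtr //; lra.
have n0 : 0 < n by rewrite sqrtr_gt0; lra.
have hw : (c - a) ^+ 2 + (d - b) ^+ 2 = n ^+ 2.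
  by rewrite n2 /sco -/a -/b -/c -/d; lra.
have hm : unit_circle R ((d - b) / n, (a - c) / n).
  rewrite /unit_circle /= !expr_div_n -mulrDl.
  have -> : (d - b) ^+ 2 + (a - c) ^+ 2 = n ^+ 2 by rewrite -hw; ring.
  by rewrite divff // expf_neq0 // lt0r_neq0.
pose m : S1 R := exist (fun z => z \in unit_circle R) _ (mem_set hm).
exists m; rewrite /arc /= /ccw.
have -> : xco m = (d - b) / n by [].
have -> : yco m = (a - c) / n by [].
rewrite -/a -/b -/c -/d.
have -> : ((d - b) / n - a) * (d - b) - ((a - c) / n - b) * (c - a) =
   n + tco u v.
  have -> : ((d - b) / n - a) * (d - b) - ((a - c) / n - b) * (c - a) =
   ((c - a) ^+ 2 + (d - b) ^+ 2) / n + tco u v.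
    by rewrite /tco -/a -/b -/c -/d; ring.
  by rewrite hw expr2 mulfK // lt0r_neq0.
have : `|tco u v| < n.
  rewrite -(@ltr_pXn2r _ 2) ?nnegrE ?normr_ge0 // ?ltW // real_normK ?num_real //.
  by rewrite n2; have := mulr_gt0 s0 s0; rewrite -expr2; lra.
by rewrite ltr_norml => /andP[]; lra.
Qed.

Lemma arc_inj u v u' v' : u <> v -> arc u v = arc u' v' -> u = u' /\ v = v'.
Proof.
move=> uv e; have [q q1] := arc_nonempty uv.
have q2 : arc u' v' q by rewrite -e.
have neu x y : ~ arc x y x by move=> /ccw_neq[].
have nev x y : ~ arc x y y by move=> /ccw_neq[].
have [uq qv _] := ccw_neq q1; have [uq' qv' _] := ccw_neq q2.
split; apply: contrapT => ne.
- have [h|h] := ccw_total ne uq' uq.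
    apply: (neu u' v'); rewrite -e; exact: ccw_trans h q1.
  apply: (neu u v); rewrite e; apply: ccw_trans q2.
  exact/ccw_rot/ccw_rot.
- have [h|h] := ccw_total qv ne qv'.
    apply: (nev u v); rewrite e; apply: ccw_rot.
    exact: ccw_trans (ccw_rot (ccw_rot q2)) (ccw_rot (ccw_rot h)).
  apply: (nev u' v'); rewrite -e; apply: ccw_rot.
  exact: ccw_trans (ccw_rot (ccw_rot q1)) (ccw_rot (ccw_rot h)).
Qed.

Lemma dual_arc u v : u <> v -> dual (arc u v) = arc v u.
Proof.
move=> uv; apply/seteqP; split=> [p [u' [v' [_ e]]]|p vup].
  by have [<- <-] := arc_inj uv e.
by exists u, v.
Qed.

End Orientation.

Section LaminationSystems.
Context {R : realType}.
Implicit Types (I J : set (S1 R)) (L gap : set (set (S1 R))).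
Implicit Types (f g : S1 R -> S1 R) (G : set (S1 R -> S1 R)).

Definition leaf I : set (set (S1 R)) := [set I; dual I].

Definition leaf_lies_on I J : Prop := I `<=` J \/ dual I `<=` J.

Definition lamination_system L : Prop :=
  [/\ L !=set0 /\ (forall I, L I -> nondegenerate_open_interval I),
      (forall I, L I -> L (dual I)),
      (forall I J, L I -> L J -> leaf_lies_on I J \/ leaf_lies_on I (dual J)) &
      (forall A : nat -> set (S1 R),
         (forall n, L (A n)) -> (forall n, A n `<=` A n.+1) ->
         nondegenerate_open_interval (\bigcup_n A n) -> L (\bigcup_n A n))].

Definition is_gap L gap : Prop :=
  [/\ gap `<=` L, trivIset gap id &
      forall I, L I -> exists2 J, gap J & leaf_lies_on I J].

Definition vertices gap : set (S1 R) := ~` \bigcup_(I in gap) I.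

Definition very_full L : Prop :=
  forall gap, is_gap L gap -> finite_set (vertices gap).

Definition endpoints L : set (S1 R) := \bigcup_(I in L) vertices (leaf I).

Definition orientation_preserving f : Prop :=
  forall u p v, ccw u p v -> ccw (f u) (f p) (f v).

Definition HomeoP : set (S1 R -> S1 R) :=
  [set f | [/\ continuous f,
               exists g, [/\ continuous g, cancel f g & cancel g f] &
               orientation_preserving f]].

Definition subgroup_HomeoP G : Prop :=
  [/\ G `<=` HomeoP, G id,
      (forall f g, G f -> G g -> G (f \o g)) &
      (forall f, G f -> exists g, [/\ G g, cancel f g & cancel g f])].

Definition invariant_under G L : Prop :=
  forall g I, G g -> L I -> L (g @` I).

Definition transverse L1 L2 : Prop := L1 `&` L2 = set0.

Definition parabolic g : Prop :=
  [/\ HomeoP g, g <> id & exists x, [set y | g y = y] = [set x]].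

Definition cusp_point G (x : S1 R) : Prop :=
  exists g, [/\ G g, parabolic g & g x = x].

Definition pants_like_collection G (T : Type) (L : T -> set (set (S1 R))) : Prop :=
  [/\ (forall a, [/\ lamination_system (L a), invariant_under G (L a) &
                     very_full (L a)]),
      (forall a b, a <> b -> transverse (L a) (L b)) &
      (forall a b, a <> b -> endpoints (L a) `&` endpoints (L b) `<=` cusp_point G)].

(* Lamination systems are nonempty, so the members of a pairwise transverse
   family are distinct and L : 'I_n -> _ lists exactly n of them. *)
Definition pants_like_COL (n : nat) G : Prop :=
  subgroup_HomeoP G /\
  exists L : 'I_n -> set (set (S1 R)), pants_like_collection G L.

(* The subspace topology induced on G by the compact-open topology of all maps
   S1 -> S1 (equivalently, by that of HomeoP) is discrete. *)
Definition discrete_in_compact_open G : Prop :=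
  G `<=` @isolated {compact-open, S1 R -> S1 R} G.

End LaminationSystems.

Arguments HomeoP : clear implicits.

(* Main.v *)
(* Write x <_p y for "(p, x, y) is counterclockwise": a complete dense linear
   order on S1 \ {p}.

   If p is not an endpoint of a very full system, arbitrarily small intervals of
   the system contain p (a rainbow): otherwise the maximal intervals missing p
   form a gap having p as a vertex, and finiteness of its vertices makes p an
   end of one of these intervals.  If p is a cusp point, iterating a parabolic
   element on a leaf ending at p gives arbitrarily short intervals (p, q) in
   every system.

   A nontrivial g in G fixes at most two points.  Otherwise take a component
   (c, d) of the complement of Fix g.  If c is a cusp point, iterating g on a
   short interval (c, q) produces (c, d) in all three systems.  If c is not a
   cusp point, then it is an endpoint of at most one system, and iterating g on
   rainbows of the other two at c produces in both the interval (c', d), where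
   c' is the fixed point preceding c.  Both cases contradict transversality.

   Finally, three intervals of the systems with disjoint closures exist.  If g
   moves a chosen point of such an interval I within I, and one of its dual
   within the dual, then g I and I are nested, so g fixes a point of the closure
   of I.  These six conditions therefore isolate the identity. *)

From mathcomp Require Import all_boot all_order all_algebra ring lra.
From mathcomp Require Import all_classical all_reals all_analysis.
(* Required last, since mathcomp's [path.arc] would shadow [Defs.arc]. *)
Require Import Defs.

Set Implicit Arguments.
Unset Strict Implicit.
Unset Printing Implicit Defensive.

Import Order.TTheory GRing.Theory Num.Theory.
Import numFieldNormedType.Exports.

Local Open Scope classical_set_scope.
Local Open Scope ring_scope.

(** * The line S1 minus a point *)

Section CyclicOrder.
Context {R : realType}.
Implicit Types a b c d p q u v x y z : S1 R.

(** An increasing bijection from S1 \ {p}, ordered by [ccw p], onto the real line, with inverse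
    [psi]; the value [phi p] is unconstrained. It turns questions of cyclic order into linear
    inequalities. *)
Definition line_chart p (phi : S1 R -> R) (psi : R -> S1 R) : Prop :=
  [/\ forall t, psi t <> p, cancel psi phi,
      forall x, x <> p -> psi (phi x) = x &
      forall x y, x <> p -> y <> p -> ccw p x y <-> phi x < phi y].

Lemma ccw_neqs u p v : ccw u p v ->
  [/\ u <> p, p <> v & u <> v] /\ [/\ p <> u, v <> p & v <> u].
Proof.
by move=> /ccw_neq[h1 h2 h3]; split; split=> //; apply: nesym.
Qed.

(** This is stereographic projection from p: in the orthogonal frame at p the circle is s^2 + t^2 =
    2 s, and the coordinate is the slope t / s of the chord from p. *)
Lemma exists_line_chart p : exists phi psi, line_chart p phi psi.
Proof.
pose s x : R := 1 - (xco p * xco x + yco p * yco x).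
pose t x : R := yco p * xco x - xco p * yco x.
have hp := S1_norm p.
have st x : s x ^+ 2 + t x ^+ 2 = 2 * s x.
  have hx := S1_norm x; rewrite /s /t.
  transitivity (1 - 2 * (xco p * xco x + yco p * yco x)
    + (xco p ^+ 2 + yco p ^+ 2) * (xco x ^+ 2 + yco x ^+ 2)); first by ring.
  by rewrite hp hx; ring.
have sE x y : ccw p x y <-> 0 < s x * t y - t x * s y.
  rewrite /ccw; set A := (X in 0 < X <-> _); set B := (X in _ <-> 0 < X).
  suff -> : A = B by [].
  rewrite /A /B /s /t.
  move: hp; set a := xco p; set b := yco p => hp.
  set c := xco x; set d := yco x; set e := xco y; set f := yco y.
  transitivity ((c * f - d * e) * (a ^+ 2 + b ^+ 2) - c * b - a * f + d * a + b * e).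
    by rewrite hp; ring.
  ring.
have s_gt0 x : x <> p -> 0 < s x.
  move=> xp; have := st x; case: (ltgtP 0 (s x)) => // [s0|s0].
    by have := sqr_ge0 (s x); have := sqr_ge0 (t x); lra.
  rewrite -s0 expr0n mulr0 /= add0r => /eqP; rewrite sqrf_eq0 => /eqP t0.
  exfalso; apply: xp.
  have hx := S1_norm x; move: s0 t0; rewrite /s /t => s0 t0.
  have : (xco x - xco p) ^+ 2 + (yco x - yco p) ^+ 2 = 0 by lra.
  move/eqP; rewrite paddr_eq0 ?sqr_ge0 // !sqrf_eq0 !subr_eq0.
  by move=> /andP[/eqP h1 /eqP h2]; exact: S1_eq.
have chart x y : x <> p -> y <> p -> ccw p x y <-> t x / s x < t y / s y.
  move=> /s_gt0 hx /s_gt0 hy; rewrite sE.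
  by rewrite ltr_pdivrMr // mulrAC ltr_pdivlMr // subr_gt0 [t y * _]mulrC.
(* The line t = r s meets the circle s^2 + t^2 = 2 s away from p at s = 2 / (1 + r^2). *)
pose w r : R := 2 / (1 + r ^+ 2).
have r0 (r : R) : 0 < 1 + r ^+ 2 by have := sqr_ge0 r; lra.
have w0 (r : R) : 0 < w r by rewrite divr_gt0.
have wr (r : R) : w r * (1 + r ^+ 2) = 2 by rewrite mulfVK // lt0r_neq0.
pose X r := xco p * (1 - w r) + yco p * (r * w r).
pose Y r := yco p * (1 - w r) - xco p * (r * w r).
have XY r : unit_circle R (X r, Y r).
  rewrite /unit_circle /= /X /Y.
  transitivity ((xco p ^+ 2 + yco p ^+ 2) * ((1 - 2 * w r) + w r * (w r * (1 + r ^+ 2)))).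
    by ring.
  by rewrite hp wr; ring.
pose psi (r : R) : S1 R := exist (fun z : R * R => z \in unit_circle R) _ (mem_set (XY r)).
have sw r : s (psi r) = w r.
  rewrite /s /xco /yco set_valE /= -/(xco p) -/(yco p) /X /Y.
  transitivity (1 - (xco p ^+ 2 + yco p ^+ 2) * (1 - w r)); first by ring.
  by rewrite hp; ring.
have tw r : t (psi r) = r * w r.
  rewrite /t /xco /yco set_valE /= -/(xco p) -/(yco p) /X /Y.
  transitivity ((xco p ^+ 2 + yco p ^+ 2) * (r * w r)); first by ring.
  by rewrite hp; ring.
have psip r : psi r <> p.
  move=> e; have := w0 r; rewrite -sw e /s.
  have -> : 1 - (xco p * xco p + yco p * yco p) = 0 by rewrite -!expr2 hp subrr.
  by rewrite ltxx.
have psiK r : t (psi r) / s (psi r) = r.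
  by rewrite tw sw mulfK // lt0r_neq0.
exists (fun x => t x / s x), psi; split=> //= x xp.
apply: contrapT => ne.
have [] := ccw_total (nesym (psip (t x / s x))) ne (nesym xp).
  by move=> /(chart _ _ (psip _) xp); rewrite psiK ltxx.
by move=> /(chart _ _ xp (psip _)); rewrite psiK ltxx.
Qed.

(** Increasing triples are counterclockwise by transitivity, and so are their rotations; each of the
    remaining orders would make x, z, y counterclockwise. *)
Lemma ccw_chart p phi psi : line_chart p phi psi ->
  forall x y z, x <> p -> y <> p -> z <> p ->
  ccw x y z <-> [\/ phi x < phi y /\ phi y < phi z,
                    phi y < phi z /\ phi z < phi x |
                    phi z < phi x /\ phi x < phi y].
Proof.
case=> _ _ _ lt.
have H x y z : x <> p -> y <> p -> z <> p -> phi x < phi y -> phi y < phi z ->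
    ccw x y z.
  move=> xp yp zp /lt h1 /lt h2.
  have {}h1 := h1 xp yp; have {}h2 := h2 yp zp.
  exact/ccw_rot/ccw_rot/(ccw_trans (ccw_rot h2) (ccw_rot (ccw_rot h1))).
have rot x y z : ccw x y z -> ccw z x y by move=> /ccw_rot/ccw_rot.
move=> x y z xp yp zp; split; last first.
  move=> [][h1 h2]; first exact: H.
    exact/rot/H.
  exact/ccw_rot/H.
move=> h; have [[n1 n2 n3] _] := ccw_neqs h.
have tot a b : a <> p -> b <> p -> a <> b -> (phi a < phi b) || (phi b < phi a).
  by move=> ap bp ab; have [/lt->|/lt->] := ccw_total (nesym ap) ab (nesym bp);
    rewrite ?orbT.
have := tot _ _ xp yp n1; have := tot _ _ yp zp n2; have := tot _ _ xp zp n3.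
have N1 : ~ (phi x < phi z /\ phi z < phi y).
  by move=> [h1 h2]; apply: (ccw_asym h); exact: H.
have N2 : ~ (phi z < phi y /\ phi y < phi x).
  by move=> [h1 h2]; apply: (ccw_asym h); apply: rot; exact: H.
have N3 : ~ (phi y < phi x /\ phi x < phi z).
  by move=> [h1 h2]; apply: (ccw_asym h); apply: ccw_rot; exact: H.
move=> /orP[] h1 /orP[] h2 /orP[] h3.
- by constructor 1.
- by case: N3.
- by case: N1.
- by move: (lt_trans h1 (lt_trans h2 h3)); rewrite ltxx.
- by move: (lt_trans h1 (lt_trans h3 h2)); rewrite ltxx.
- by constructor 2.
- by constructor 3.
- by case: N2.
Qed.

Definition coord p : S1 R -> R := projT1 (cid (exists_line_chart p)).

Definition point_at p : R -> S1 R :=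
  projT1 (cid (projT2 (cid (exists_line_chart p)))).

Lemma coordP p : line_chart p (coord p) (point_at p).
Proof. exact: (projT2 (cid (projT2 (cid (exists_line_chart p))))). Qed.

Lemma ccwE p x y z : x <> p -> y <> p -> z <> p ->
  ccw x y z <-> [\/ coord p x < coord p y /\ coord p y < coord p z,
                    coord p y < coord p z /\ coord p z < coord p x |
                    coord p z < coord p x /\ coord p x < coord p y].
Proof. exact: (ccw_chart (coordP p)). Qed.

(** The inequalities are weak because the three points may coincide. *)
Lemma nccwE p x y z : x <> p -> y <> p -> z <> p -> ~ ccw x y z ->
  [\/ coord p z <= coord p y /\ coord p y <= coord p x,
      coord p y <= coord p x /\ coord p x <= coord p z |
      coord p x <= coord p z /\ coord p z <= coord p y].
Proof.
move=> xp yp zp; rewrite (ccwE xp yp zp).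
case: (ltP (coord p x) (coord p y)) => h1;
  case: (ltP (coord p y) (coord p z)) => h2;
  case: (ltP (coord p z) (coord p x)) => h3 // h.
- by case: h; constructor 1.
- by case: h; constructor 1.
- by case: h; constructor 3.
- by constructor 3.
- by case: h; constructor 2.
- by constructor 2.
- by constructor 1.
- by constructor 2.
Qed.

Lemma ccw1E p x y : ccw p x y -> [/\ x <> p, y <> p & coord p x < coord p y].
Proof.
move=> h; have [[n1 n2 n3] [n1' n2' n3']] := ccw_neqs h; split=> //.
by have [_ _ _ <-] := coordP p.
Qed.

Lemma ccw2E p x y : ccw x p y -> [/\ x <> p, y <> p & coord p y < coord p x].
Proof. by move=> /ccw_rot/ccw1E[]. Qed.

Lemma ccw3E p x y : ccw x y p -> [/\ x <> p, y <> p & coord p x < coord p y].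
Proof. by move=> /ccw_rot/ccw_rot/ccw1E[]. Qed.

Lemma nccw1E p x y : x <> p -> y <> p -> ~ ccw p x y -> coord p y <= coord p x.
Proof.
by move=> xp yp; have [_ _ _ ->] := coordP p => //; move/negP; rewrite -leNgt.
Qed.

Lemma nccw2E p x y : x <> p -> y <> p -> ~ ccw x p y -> coord p x <= coord p y.
Proof. by move=> xp yp h; apply: nccw1E => // /ccw_rot/ccw_rot. Qed.

Lemma nccw3E p x y : x <> p -> y <> p -> ~ ccw x y p -> coord p y <= coord p x.
Proof. by move=> xp yp h; apply: nccw1E => // /ccw_rot. Qed.

Lemma coord_inj p x y : x <> p -> y <> p -> coord p x = coord p y -> x = y.
Proof.
by have [_ _ h _] := coordP p => xp yp e; rewrite -(h x) // -(h y) // e.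
Qed.

Lemma coord_neq p x y : x <> p -> y <> p -> x <> y ->
  coord p x < coord p y \/ coord p y < coord p x.
Proof.
move=> xp yp xy; case: (ltgtP (coord p x) (coord p y)) => h; [by left|by right|].
by case: xy; exact: coord_inj h.
Qed.

End CyclicOrder.

(* lra fails on hypotheses such as equalities in S1, hence the clearing. *)
Ltac line_lra :=
  repeat match goal with
  | H : ?P |- _ =>
      lazymatch P with
      | is_true _ => fail
      | _ => lazymatch type of P with Prop => clear H end
      end
  end; lra.

(* Decides goals about the cyclic order by contradiction, reading every
   [ccw] fact in the line S1 \ p. *)
Ltac circ p :=
  intros; try assumption;
  repeat match goal with
  | H : context [arc ?u ?v ?y] |- _ => change (arc u v y) with (ccw u y v) in H
  | |- context [arc ?u ?v ?y] => change (arc u v y) with (ccw u y v)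
  end;
  repeat match goal with
  | |- _ /\ _ => split
  | |- and3 _ _ _ => split
  | |- and4 _ _ _ _ => split
  end;
  match goal with
  | |- False => idtac
  | |- ~ _ => intro
  | |- _ => apply: contrapT => ?
  end;
  repeat match goal with H : ~ (_ <> _) |- _ => move/contrapT: H => H end;
  (* Equations eliminate any point except p, which must survive as the base point. *)
  repeat match goal with
  | H : ?x = ?y |- _ =>
      first [ assert_fails (constr_eq x p); subst x
            | assert_fails (constr_eq y p); subst y ]
  end;
  repeat match goal with
  | H : ccw p ?x ?y |- _ => case/ccw1E: H => ? ? ?
  | H : ccw ?x p ?y |- _ => case/ccw2E: H => ? ? ?
  | H : ccw ?x ?y p |- _ => case/ccw3E: H => ? ? ?
  | H : p <> ?x |- _ => move/nesym: H => H
  end;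
  try congruence;
  repeat match goal with
  | H : ~ ccw p ?x ?y, H1 : ?x <> p, H2 : ?y <> p |- _ =>
      move/(nccw1E H1 H2): H => H
  | H : ~ ccw ?x p ?y, H1 : ?x <> p, H2 : ?y <> p |- _ =>
      move/(nccw2E H1 H2): H => H
  | H : ~ ccw ?x ?y p, H1 : ?x <> p, H2 : ?y <> p |- _ =>
      move/(nccw3E H1 H2): H => H
  end;
  repeat match goal with
  | H : ccw ?x ?y ?z, H1 : ?x <> p, H2 : ?y <> p, H3 : ?z <> p |- _ =>
      case/(ccwE H1 H2 H3): H => [[? ?]|[? ?]|[? ?]]; try line_lra
  end; try line_lra;
  repeat match goal with
  | H : ~ ccw ?x ?y ?z, H1 : ?x <> p, H2 : ?y <> p, H3 : ?z <> p |- _ =>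
      case/(nccwE H1 H2 H3): H => [[? ?]|[? ?]|[? ?]]; try line_lra
  end; try line_lra;
  repeat match goal with
  | H : ?x <> ?y, H1 : ?x <> p, H2 : ?y <> p |- _ =>
      case: (coord_neq H1 H2 H) => ?; clear H
  end; line_lra.

(** * Completeness and separability of the punctured circle *)

Section Completeness.
Context {R : realType}.
Implicit Types a b c d p q u v x y z : S1 R.

Lemma arc_below p x : x <> p -> exists y, ccw p y x.
Proof. by move=> /nesym/arc_nonempty[y h]; exists y; circ p. Qed.

Lemma line_sup p (A : set (S1 R)) b : A !=set0 -> b <> p ->
  (forall x, A x -> x <> p /\ ~ ccw p b x) ->
  exists s, [/\ s <> p, forall x, A x -> ~ ccw p s x &
                forall y, ccw p y s -> exists2 x, A x & ccw p y x].
Proof.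
move=> [a Aa] bp Ab; have [psip phiK psiK lt] := coordP p.
have ubA : has_sup (coord p @` A).
  split; first by exists (coord p a), a.
  exists (coord p b) => _ [x Ax <-]; have [xp h] := Ab _ Ax; exact: nccw1E.
exists (point_at p (sup (coord p @` A))); split=> //.
- move=> x Ax /ccw1E[_ _]; rewrite phiK ltNge => /negP; apply.
  by apply: (sup_upper_bound ubA); exists x.
- move=> y /ccw1E[yp _]; rewrite phiK => /(sup_gt (proj1 ubA))[_ [x Ax <-] h].
  by exists x => //; apply/lt => //; have [] := Ab _ Ax.
Qed.

(** A countable dense set lets an arbitrary union of intervals be rewritten as an increasing
    sequence, the form that the closure axiom of a lamination system accepts. *)
Lemma dense_sequence (p : S1 R) : exists D : nat -> S1 R,
  (forall n, D n <> p) /\ forall x y, ccw p x y -> exists n, ccw p x (D n) /\ ccw p (D n) y.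
Proof.
have [psip phiK psiK lt] := coordP p.
(* The rationals, seen through the chart; [odflt 0] covers the codes that decode to no rational. *)
exists (fun n => point_at p (ratr (odflt 0 (unpickle n : option rat)))); split=> // x y.
move=> /ccw1E[xp yp] /rat_in_itvoo[q]; rewrite inE => /andP[h1 h2].
by exists (pickle q); rewrite pickleK /= !lt // phiK.
Qed.

End Completeness.

(** * Circle homeomorphisms with a fixed point *)

Section Automorphisms.
Context {R : realType}.
Implicit Types (a b c d e p q u v w x y z s : S1 R) (g h : S1 R -> S1 R).

(** A homeomorphism is kept as an automorphism of the cyclic order; with the inverse explicit,
    arguments can exchange [g] and [g']. *)
Definition circle_auto g g' : Prop :=
  [/\ cancel g g', cancel g' g, orientation_preserving g &
      orientation_preserving g'].

Lemma circle_auto_sym g g' : circle_auto g g' -> circle_auto g' g.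
Proof. by case. Qed.

Lemma auto_ccw g g' x y z : circle_auto g g' ->
  ccw (g x) (g y) (g z) <-> ccw x y z.
Proof.
by move=> [gK g'K og og']; split=> [/og'|/og//]; rewrite !gK.
Qed.

Lemma auto_arc g g' u v : circle_auto g g' -> g @` arc u v = arc (g u) (g v).
Proof.
move=> gg'; have [gK g'K og og'] := gg'; apply/seteqP; split.
  by move=> _ [x ux <-]; exact: og.
by move=> y uy; exists (g' y); rewrite ?g'K //; apply/(auto_ccw _ _ _ gg'); rewrite g'K.
Qed.

Lemma auto_inj g g' : circle_auto g g' -> injective g.
Proof. by case=> /can_inj. Qed.

Lemma auto_fix g g' x : circle_auto g g' -> g' x = x <-> g x = x.
Proof.
by case=> gK g'K _ _; split=> [{1}<-|{1}<-]; rewrite ?g'K ?gK.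
Qed.

Lemma iter_auto g g' n : circle_auto g g' ->
  circle_auto (iter n g) (iter n g').
Proof.
move=> [gK g'K og og']; elim: n => [|n [K K' o o']]; first by split.
split=> [x|x|u x v /o/og//|u x v /o'/og'//].
  by rewrite iterSr /= gK K.
by rewrite iterSr /= g'K K'.
Qed.

Lemma iter_fix g x n : g x = x -> iter n g x = x.
Proof. by move=> gx; elim: n => //= n ->. Qed.

Lemma auto_ccw_fix g g' p x y : circle_auto g g' -> g p = p ->
  ccw p (g x) (g y) <-> ccw p x y.
Proof. by move=> gg' gp; rewrite -{1}gp; exact: auto_ccw gg'. Qed.

Section Orbit.
Variables (g g' : S1 R -> S1 R) (p : S1 R).
Hypotheses (gg' : circle_auto g g') (gp : g p = p).

(** An order automorphism fixing p commutes with suprema in S1 \ p, so the supremum of the fixed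
    points not above b is itself fixed. *)
Lemma sup_of_fixed_points b :
  b <> p -> (exists2 x, g x = x & x <> p /\ ~ ccw p b x) ->
  exists s, [/\ g s = s, s <> p, ~ ccw p b s &
    forall x, g x = x -> x <> p -> ~ ccw p b x -> ~ ccw p s x].
Proof.
move=> bp [x0 gx0 [x0p bx0]].
pose A := [set x | [/\ g x = x, x <> p & ~ ccw p b x]].
have [|x [_ xp bx] //|s [sp sub slub]] := @line_sup _ p A b _ bp.
  by exists x0; split.
have gsp : g s <> p by rewrite -gp => /(auto_inj gg').
exists s; split=> //.
- apply: contrapT => ne; have [h|h] := ccw_total (nesym gsp) ne (nesym sp).
    have [x Ax] := slub _ h.
    have [gx xp _] := Ax; rewrite -gx (auto_ccw_fix _ _ gg' gp).
    exact: sub.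
  have : ccw p (g' s) s.
    by rewrite -(auto_ccw_fix _ _ gg' gp); case: gg' => _ -> _ _.
  move=> /slub[x Ax]; rewrite -(auto_ccw_fix _ _ gg' gp).
  by case: gg' => _ -> _ _; case: (Ax) => -> _ _; exact: sub.
- move=> /slub[x [_ _ bx]] /[dup] h; circ p.
- by move=> x gx xp bx; exact: sub.
Qed.

Lemma orbit_up x n : ccw p x (g x) -> ccw p (iter n g x) (iter n.+1 g x).
Proof.
move=> xgx; rewrite iterSr.
by apply/(auto_ccw_fix _ _ (iter_auto n gg') (iter_fix n gp)).
Qed.

(** A bounded increasing orbit has a supremum, which g fixes because shifting the orbit by one step
    does not change it. *)
Lemma orbit_sup x b : ccw p x (g x) -> b <> p ->
  (forall n, ~ ccw p b (iter n g x)) ->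
  exists s, [/\ g s = s, ~ ccw p b s, ccw p x s,
    forall n, ccw p (iter n g x) s &
    forall y, ccw p y s -> exists n, ccw p y (iter n g x)].
Proof.
move=> xgx bp xb.
have np n : iter n g x <> p by have := orbit_up n xgx; circ p.
have [|_ [n _ <-]|s [sp sub slub]] :=
    @line_sup _ p (range (fun n => iter n g x)) b _ bp.
- by exists x, 0%N.
- by split.
have gsp : g s <> p by rewrite -gp => /(auto_inj gg').
have below n : ccw p (iter n g x) s.
  have h := orbit_up n xgx; have h' : ~ ccw p s (iter n.+1 g x).
    by apply: sub; exists n.+1.
  by circ p.
exists s; split=> //.
- apply: contrapT => ne; have [h|h] := ccw_total (nesym gsp) ne (nesym sp).
    have [_ [n _ <-] h'] := slub _ h.
    have := below n; rewrite -(auto_ccw_fix _ _ gg' gp) => h2.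
    by have := orbit_up n xgx; rewrite /=; circ p.
  have : ccw p (g' s) s.
    by rewrite -(auto_ccw_fix _ _ gg' gp); case: gg' => _ -> _ _.
  move=> /slub[_ [n _ <-]]; rewrite -(auto_ccw_fix _ _ gg' gp).
  by case: gg' => _ -> _ _; apply: sub; exists n.+1.
- by move=> /slub[_ [n _ <-]]; exact: xb.
- exact: (below 0%N).
- by move=> y /slub[_ [n _ <-]]; exists n.
Qed.

Lemma orbit_unbounded x b : ccw p x (g x) -> b <> p ->
  (forall y, g y = y -> ~ ccw p x y) -> exists n, ccw p b (iter n g x).
Proof.
move=> xgx bp nofix; apply: contrapT => no.
have [n h|s [gs _ xs _ _]] := orbit_sup xgx bp; first by apply: no; exists n.
exact: nofix xs.
Qed.

(** An intermediate value argument in terms of order alone: the orbit of y increases and cannot pass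
    z, which g moves down, so it converges to a fixed point. *)
Lemma fixed_between y z : ccw p y z -> ccw p y (g y) -> ccw p (g z) z ->
  exists s, [/\ g s = s, ccw p y s & ccw p s z].
Proof.
move=> yz ygy gzz; have [[zp _ _] _] := ccw_neqs gzz.
have lez n : ccw p (iter n g y) z.
  elim: n => //= n ih; have : ccw p (g (iter n g y)) (g z).
    by apply/(auto_ccw_fix _ _ gg' gp).
  by circ p.
have [|n|s [gs zs ys _ _]] := @orbit_sup y z ygy.
- by circ p.
- by have := lez n; circ p.
exists s; split=> //; have ne : s <> z by move=> sz; rewrite -sz gs in gzz; circ p.
by circ p.
Qed.

End Orbit.

End Automorphisms.

(** * Convex open sets of the line are intervals *)

Section Intervals.
Context {R : realType}.
Implicit Types (a b c d e p q u v w x y z s : S1 R) (U : set (S1 R)).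

Lemma line_inf p U b : U !=set0 -> b <> p ->
  (forall x, U x -> x <> p /\ ~ ccw p x b) ->
  exists l, [/\ l <> p, forall x, U x -> ~ ccw p x l &
                forall y, ccw p l y -> exists2 x, U x & ccw p x y].
Proof.
move=> [x0 Ux0] bp Ub; have [x0p _] := Ub _ Ux0.
have [|x [xp lbx]|l [lp sub slub]] :=
    @line_sup _ p [set y | y <> p /\ forall x, U x -> ~ ccw p x y] x0 _ x0p.
- by exists b; split=> // x /Ub[].
- by split=> //; exact: lbx.
exists l; split=> //.
- by move=> x Ux /slub[y [_ /(_ _ Ux)]].
- move=> y ly; apply: contrapT => no; apply: (sub y) (ly); split.
    by circ p.
  by move=> x Ux xy; apply: no; exists x.
Qed.

(* An unbounded end of U is the point p itself. *)
Lemma convex_open_interval p U a : U !=set0 -> ~ U p ->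
  (forall x y z, U x -> U z -> ccw p x y -> ccw p y z -> U y) ->
  (forall x, U x -> exists y z, [/\ U y, U z, ccw p y x & ccw p x z]) ->
  a <> p -> ~ U a -> nondegenerate_open_interval U.
Proof.
move=> [x0 Ux0] Up cvx opn ap Ua.
have Unp x : U x -> x <> p by move=> Ux xp; rewrite xp in Ux.
have x0p := Unp _ Ux0.
(* The right end is the supremum of U, or p when U is unbounded above; the left end l is found
   likewise. *)
have [r [hr Ur]] : exists r, (r = p \/ ccw p x0 r) /\
    forall y, ccw p x0 y -> (U y <-> ccw x0 y r).
  have [[b [bp Ub]]|nb] := pselect (exists b, b <> p /\
      forall x, U x -> ~ ccw p b x).
    have [|x Ux|s [sp sub slub]] := @line_sup _ p U b _ bp; first by exists x0.
      by split; [exact: Unp|exact: Ub].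
    have [y [z [_ Uz _ x0z]]] := opn _ Ux0.
    have x0s : ccw p x0 s by have := sub _ Uz; circ p.
    exists s; split; first by right.
    move=> w x0w; split=> [Uw|h].
      by have [_ [v [_ /sub vs _ wv]]] := opn _ Uw; circ p.
    have /slub[v Uv wv] : ccw p w s by circ p.
    exact: (cvx x0 w v).
  exists p; split; first by left.
  move=> y x0y; split=> [_|_]; first by circ p.
  apply: contrapT => nUy; apply: nb; exists y; split; first by circ p.
  by move=> x Ux yx; apply: nUy; exact: (cvx x0 y x).
have [l [hl Ul]] : exists l, (l = p \/ ccw p l x0) /\
    forall y, ccw p y x0 -> (U y <-> ccw l y x0).
  have [[b [bp Ub]]|nb] := pselect (exists b, b <> p /\
      forall x, U x -> ~ ccw p x b).
    have [|x Ux|s [sp sub slub]] := @line_inf p U b _ bp; first by exists x0.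
      by split; [exact: Unp|exact: Ub].
    have [y [z [Uy _ yx0 _]]] := opn _ Ux0.
    have sx0 : ccw p s x0 by have := sub _ Uy; circ p.
    exists s; split; first by right.
    move=> w wx0; split=> [Uw|h].
      by have [v [_ [/sub vs _ vw _]]] := opn _ Uw; circ p.
    have /slub[v Uv vw] : ccw p s w by circ p.
    exact: (cvx v w x0).
  exists p; split; first by left.
  move=> y yx0; split=> [_|_]; first by circ p.
  apply: contrapT => nUy; apply: nb; exists y; split; first by circ p.
  by move=> x Ux xy; apply: nUy; exact: (cvx x y x0).
have side y : y <> p -> [\/ y = x0, ccw p x0 y | ccw p y x0].
  move=> yp; have [->|ne] := pselect (y = x0); first by constructor 1.
  by have [] := ccw_total (nesym x0p) (nesym ne) (nesym yp);
    [constructor 2|constructor 3].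
(* Equal ends could only both be p, but then U would be all of S1 \ p and contain a. *)
have lr : l <> r.
  move=> lr; subst r; case: hl hr => [lp _|lx0 [lp|x0l]]; last 2 first.
  - by circ p.
  - by circ p.
  case: (side _ ap) => [ax|h|h].
  - by rewrite ax in Ua.
  - by apply: Ua; apply/(Ur _ h); circ p.
  - by apply: Ua; apply/(Ul _ h); circ p.
exists l, r; split=> //; apply/seteqP; split=> y; last first.
  move=> lyr; have yp : y <> p.
    by move=> yp; case: hl hr => [?|?] [?|?]; circ p.
  case: (side _ yp) => [->//|h|h].
  - by apply/(Ur _ h); case: hl hr => [?|?] [?|?]; circ p.
  - by apply/(Ul _ h); case: hl hr => [?|?] [?|?]; circ p.
move=> Uy; case: (side _ (Unp _ Uy)) => [->|h|h].
- by case: hl hr => [?|?] [?|?]; circ p.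
- by have := (Ur _ h).1 Uy; case: hl hr => [?|?] [?|?]; circ p.
- by have := (Ul _ h).1 Uy; case: hl hr => [?|?] [?|?]; circ p.
Qed.

Lemma line_lower_bound p (s : seq (S1 R)) :
  exists2 x0, x0 <> p & forall v, v \in s -> v <> p -> ccw p x0 v.
Proof.
elim: s => [|w s [x0 x0p ih]].
  by exists (point_at p 0) => //; have [] := coordP p.
have [->|wp] := pselect (w = p).
  exists x0 => // v; rewrite inE => /orP[/eqP->//|/ih//].
have [x1 [x10 x1w]] : exists x1, ccw p x1 x0 /\ ccw p x1 w.
  have [h|h] := pselect (ccw p x0 w).
    by have [x1 h1] := arc_below x0p; exists x1; split; circ p.
  by have [x1 h1] := arc_below wp; exists x1; split; circ p.
exists x1; first by circ p.
by move=> v; rewrite inE => /orP[/eqP->//|/ih h /h]; circ p.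
Qed.

End Intervals.

Lemma sub_arc {R : realType} (p v u v' u' : S1 R) : ccw p v u -> ccw p v' u' ->
  ~ ccw p v v' -> ~ ccw p u' u -> arc v u `<=` arc v' u'.
Proof.
move=> vu vu' vv' uu' y h; have yp : y <> p by move=> yp; circ p.
by circ p.
Qed.

(** * Rainbows *)

Section Laminations.
Context {R : realType}.
Implicit Types (a b c d e p q u v w x y z s : S1 R) (I J K X : set (S1 R)).
Variable L : set (set (S1 R)).
Hypothesis lamL : lamination_system L.

Lemma lamination_arc I : L I -> exists u v, u <> v /\ I = arc u v.
Proof. by case: lamL => [[_ h] _ _ _] /h. Qed.

Lemma lamination_dual u v : L (arc u v) -> u <> v -> L (arc v u).
Proof. by case: lamL => [_ h _ _] /h + uv; rewrite dual_arc. Qed.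

Lemma lamination_neq u v : L (arc u v) -> u <> v.
Proof.
move=> /lamination_arc[u' [v' [uv' e]]] uv.
have [x] := arc_nonempty uv'; rewrite -e uv => /ccw_neq[? ? ?]; congruence.
Qed.

(** The four ends cut the circle into four nonempty arcs, and a point of each refutes one of the
    four inclusions offered by the second axiom. *)
Lemma unlinked v u v' u' : L (arc v u) -> L (arc v' u') ->
  ccw v v' u -> ccw u u' v -> False.
Proof.
move=> LI LJ h1 h2; have := lamination_neq LI; have := lamination_neq LJ.
case: lamL => [_ _ h _] vu' vu; have := h _ _ LI LJ.
rewrite /leaf_lies_on !dual_arc //.
have [x1 h3] := arc_nonempty (v := v') (u := v) ltac:(circ v).
have [x2 h4] := arc_nonempty (v := u) (u := v') ltac:(circ v).
have [x3 h5] := arc_nonempty (v := u') (u := u) ltac:(circ v).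
have [x4 h6] := arc_nonempty (v := v) (u := u') ltac:(circ v).
move=> [[]|[]] sub.
- by suff /sub : arc v u x1; circ v.
- by suff /sub : arc u v x4; circ v.
- by suff /sub : arc v u x2; circ u.
- by suff /sub : arc u v x3; circ u.
Qed.

Lemma endpoint_arc u v : L (arc u v) -> endpoints L u /\ endpoints L v.
Proof.
move=> Luv; have uv := lamination_neq Luv.
have N w : w = u \/ w = v -> ~ arc u v w /\ ~ arc v u w.
  by move=> [->|->]; split=> /ccw_neq[].
split; exists (arc u v) => //; rewrite /vertices /leaf => -[I [->|->]];
  rewrite ?dual_arc //; apply: (N _ _).1 || apply: (N _ _).2; tauto.
Qed.

Lemma not_endpoint_dual u v p : ~ endpoints L p -> L (arc u v) ->
  ~ arc u v p -> arc v u p.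
Proof.
move=> pE Luv uvp; apply: contrapT => vup; apply: pE.
exists (arc u v) => // -[I [->|->]] //=.
by rewrite dual_arc //; exact: lamination_neq.
Qed.

Section Rainbow.
Variable p : S1 R.
Hypothesis pE : ~ endpoints L p.

Definition avoiding : set (set (S1 R)) := [set I | L I /\ ~ I p].

(** As p is not an endpoint, it lies in the dual, so I is a bounded interval of the line S1 \ p. *)
Lemma avoiding_arc I : avoiding I -> exists v u, I = arc v u /\ ccw p v u.
Proof.
move=> [LI Ip]; have [v [u [_ E]]] := lamination_arc LI.
exists v, u; split=> //; rewrite E in LI Ip.
by have := not_endpoint_dual pE LI Ip; circ p.
Qed.

(** The common point excludes disjointness and [unlinked] excludes partial overlap; only nesting
    remains. *)
Lemma avoiding_chain I J x : avoiding I -> avoiding J -> I x -> J x ->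
  I `<=` J \/ J `<=` I.
Proof.
move=> FI FJ; have [v [u [E vu]]] := avoiding_arc FI.
have [v' [u' [E' vu']]] := avoiding_arc FJ.
move: FI FJ; rewrite {I}E {J}E' => -[LI Ip] [LJ Jp] Ix Jx.
have xp : x <> p by move=> xp; rewrite xp in Ix.
have N1 : ~ (ccw p v v' /\ ccw p u u').
  by move=> [h1 h2]; apply: (unlinked LI LJ); circ p.
have N2 : ~ (ccw p v' v /\ ccw p u' u).
  by move=> [h1 h2]; apply: (unlinked LJ LI); circ p.
have [A|A] := pselect (ccw p v v').
  have B : ~ ccw p u u' by move=> B; apply: N1.
  by right; apply: (sub_arc (p := p)) => //; clear Ix Jx; circ p.
have [C|C] := pselect (ccw p u' u).
  have B : ~ ccw p v' v by move=> B; apply: N2.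
  by right; apply: (sub_arc (p := p)) => //; clear Ix Jx; circ p.
by left; apply: (sub_arc (p := p)) => //; clear Ix Jx; circ p.
Qed.

Lemma avoiding_union I J x : avoiding I -> avoiding J -> I x -> J x ->
  avoiding (I `|` J).
Proof.
move=> FI FJ Ix Jx; have [/setUidr->//|/setUidl->//] := avoiding_chain FI FJ Ix Jx.
Qed.

End Rainbow.
End Laminations.

(** * Maximal intervals missing a point *)

Section Hull.
Context {R : realType}.
Implicit Types (a b c d e p q u v w x y z s : S1 R) (I J K X : set (S1 R)).

Definition avoiding_above (L : set (set (S1 R))) p (J0 : set (S1 R)) :
  set (set (S1 R)) := [set I | avoiding L p I /\ J0 `<=` I].

Definition avoiding_hull (L : set (set (S1 R))) p (J0 : set (S1 R)) :
  set (S1 R) := \bigcup_(I in avoiding_above L p J0) I.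

Variables (L : set (set (S1 R))) (p : S1 R) (J0 : set (S1 R)).
Hypotheses (lamL : lamination_system L) (pE : ~ endpoints L p).
Hypothesis FJ0 : avoiding L p J0.

Notation above := (avoiding_above L p J0).
Notation U := (avoiding_hull L p J0).

Lemma avoiding_nonempty I : avoiding L p I -> I !=set0.
Proof.
move=> FI; have [v [u [-> vu]]] := avoiding_arc lamL pE FI.
by apply: arc_nonempty; circ p.
Qed.

(** All members contain the nonempty [J0], so any two of them meet and are nested. *)
Lemma avoiding_above_union I J : above I -> above J -> above (I `|` J).
Proof.
move=> [FI sI] [FJ sJ]; have [x J0x] := avoiding_nonempty FJ0.
split; first exact: (avoiding_union lamL pE FI FJ (sI _ J0x) (sJ _ J0x)).
by move=> y /sI; left.
Qed.

Lemma above_convex I x y z : above I -> I x -> I z -> ccw p x y -> ccw p y z -> I y.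
Proof.
move=> [FI _]; have [v [u [-> vu]]] := avoiding_arc lamL pE FI.
by clear -vu; move=> h1 h2 h3 h4; circ p.
Qed.

Lemma hull_above x z : U x -> U z -> exists2 I, above I & I x /\ I z.
Proof.
move=> [I aI Ix] [J aJ Jz]; exists (I `|` J); first exact: avoiding_above_union.
by split; [left|right].
Qed.

Lemma hull_interval a b : ccw p b a ->
  (forall I, avoiding L p I -> I a -> I b -> False) ->
  nondegenerate_open_interval U.
Proof.
move=> ba no.
have [c cp Uc] : exists2 c, c <> p & ~ U c.
  have [Ua|Ua] := pselect (U a); last by exists a => //; have [] := ccw1E ba.
  have [Ub|Ub] := pselect (U b); last by exists b => //; have [] := ccw1E ba.
  by have [I [FI _] [Ia Ib]] := hull_above Ua Ub; case: (no I).
apply: (@convex_open_interval _ p U c) => //.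
- by have [x] := avoiding_nonempty FJ0; exists x; exists J0 => //; split.
- by move=> [I [[_ Ip] _] /Ip].
- move=> x y z Ux Uz xy yz; have [I aI [Ix Iz]] := hull_above Ux Uz.
  by exists I => //; exact: above_convex xy yz.
- move=> x [I aI Ix]; have [FI _] := aI.
  have [v [u [E vu]]] := avoiding_arc lamL pE FI; rewrite E in Ix.
  have [nvx nxu _] := ccw_neq Ix.
  have [y hy] := arc_nonempty nvx.
  have [z hz] := arc_nonempty nxu.
  have xp : x <> p by move=> xp; rewrite xp in Ix; case: FI => _; rewrite E.
  have [yp zp] : y <> p /\ z <> p.
    by clear -vu Ix hy hz; split => e; subst; circ x.
  exists y, z; split.
  + by exists I => //; rewrite E; clear -vu Ix hy; circ v.
  + by exists I => //; rewrite E; clear -vu Ix hz; circ u.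
  + by clear -vu Ix hy xp yp; circ p.
  + by clear -vu Ix hz xp zp; circ p.
Qed.

(** The union is exhausted by an increasing sequence: each dense point of it brings in one member
    containing that point, and convexity supplies the points in between. *)
Lemma hull_avoiding a b : ccw p b a ->
  (forall I, avoiding L p I -> I a -> I b -> False) -> avoiding L p U.
Proof.
move=> ba no; have ndU := hull_interval ba no.
split; last by move=> [I [[_ Ip] _] /Ip].
have [D [Dp Dd]] := dense_sequence p.
have aJ0 : above J0 by split.
have /choice[K KP] : forall n, exists I, above I /\ (U (D n) -> I (D n)).
  move=> n; have [[I aI ID]|nU] := pselect (U (D n)); first by exists I.
  by exists J0.
(* The member chosen for [D n] enters at index n + 1. *)
pose A := fix A n := if n is m.+1 then A m `|` K m else J0.
have aA n : above (A n) by elim: n => //= n ih; apply: avoiding_above_union => //; exact: (KP n).1.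
have AS n : A n `<=` A n.+1 by move=> x; left.
have Amono n m : (n <= m)%N -> A n `<=` A m.
  by move=> /subnK<-; elim: (m - n)%N => // k ih x /ih; exact: AS.
have UA : U = \bigcup_n A n.
  apply/seteqP; split=> x; last by move=> [n _ Anx]; exists (A n).
  move=> [J aJ Jx]; have [FJ _] := aJ.
  have [v [u [E vu]]] := avoiding_arc lamL pE FJ.
  have xp : x <> p by move=> xp; case: FJ => _; rewrite -xp.
  rewrite E in Jx.
  (* Dense points of J on either side of x belong to a common [A] of large index, which then
     contains x by convexity. *)
  have [i [vi ix]] : exists i, ccw p v (D i) /\ ccw p (D i) x.
    by apply: Dd; clear -vu Jx xp; circ p.
  have [j [xj ju]] : exists j, ccw p x (D j) /\ ccw p (D j) u.
    by apply: Dd; clear -vu Jx xp; circ p.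
  have UD k : arc v u (D k) -> A k.+1 (D k).
    by move=> Jk; right; apply: (KP k).2; exists J => //; rewrite E.
  exists (maxn i j).+1 => //.
  apply: (above_convex (aA _) (x := D i) (z := D j)) => //.
    apply: (Amono i.+1); first by rewrite ltnS leq_maxl.
    by apply: UD; clear -vu Jx xp vi ix; circ p.
  apply: (Amono j.+1); first by rewrite ltnS leq_maxr.
  by apply: UD; clear -vu Jx xp xj ju; circ p.
have [_ _ _ lim] := lamL; rewrite UA; apply: lim => // [n|]; last by rewrite -UA.
by have [[]] := aA n.
Qed.

End Hull.

Section Rainbow.
Context {R : realType}.
Implicit Types (a b c d e p q u v w x y z s : S1 R) (I J K X : set (S1 R)).

(* Otherwise the maximal intervals of L missing p form a gap with p as a
   vertex; finitely many vertices force p to be an end of one of them. *)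
Lemma rainbow (L : set (set (S1 R))) p a b :
  lamination_system L -> very_full L -> ~ endpoints L p -> ccw p b a ->
  exists v u, [/\ L (arc v u), ccw p v b & ccw p a u].
Proof.
move=> lamL vfL pE ba.
have [[I [FI Ia Ib]]|no] := pselect (exists I, [/\ avoiding L p I, I a & I b]).
  have [v [u [E vu]]] := avoiding_arc lamL pE FI.
  exists v, u; rewrite E in Ia Ib; case: FI; rewrite E => LI Ip; split=> //.
    by clear -vu Ia Ib ba; circ p.
  by clear -vu Ia Ib ba; circ p.
pose gap := [set X | avoiding L p X /\
  forall Z, avoiding L p Z -> X `<=` Z -> Z = X].
have hullP J : avoiding L p J -> gap (avoiding_hull L p J).
  move=> FJ; split.
    by apply: (hull_avoiding lamL pE FJ ba) => I FI Ia Ib; apply: no; exists I.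
  move=> Z FZ UZ; apply/seteqP; split=> // x Zx; exists Z => //; split=> //.
  by move=> y Jy; apply: UZ; exists J => //; split.
have gapG : is_gap L gap.
  split.
  - by move=> X [[LX _] _].
  - move=> X Y [FX mX] [FY mY] [x [Xx Yx]].
    have [XY|YX] := avoiding_chain lamL pE FX FY Xx Yx.
      by rewrite -(mX _ FY XY).
    by rewrite -(mY _ FX YX).
  - move=> I LI; have [v [u [vu E]]] := lamination_arc lamL LI.
    have [Ip|Ip] := pselect (I p).
      have FI : avoiding L p (dual I).
        split; first by case: lamL => _ h _ _; exact: h.
        by rewrite E dual_arc // in Ip *; clear -Ip; circ p.
      exists (avoiding_hull L p (dual I)); first exact: hullP.
      by right=> x Ix; exists (dual I) => //; split.
    have FI : avoiding L p I by [].
    exists (avoiding_hull L p I); first exact: hullP.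
    by left=> x Ix; exists I => //; split.
have vp : vertices gap p by move=> [X [[_ Xp] _] /Xp].
have /finite_seqP[s Vs] := vfL _ gapG.
(* No point of S1 \ p up to x0 is a vertex, so the gap covers x0 by some X, and also the left end v
   of X by some Y. *)
have [x0 x0p x0s] := line_lower_bound p s.
have inV x : ~ vertices gap x -> exists2 X, gap X & X x.
  by move=> /contrapT[X gX Xx]; exists X.
have x0V y : y <> p -> ~ ccw p x0 y -> ~ vertices gap y.
  by move=> yp x0y; rewrite Vs /= => /x0s/(_ yp).
have [X gX Xx0] : exists2 X, gap X & X x0.
  by apply/inV/x0V => // /ccw_neq[].
have [v [u [E vu]]] := avoiding_arc lamL pE gX.1.
rewrite E in Xx0.
have [Y gY Yv] : exists2 X, gap X & X v.
  by apply/inV/x0V; clear -vu Xx0 x0p; circ p.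
have [v' [u' [E' vu']]] := avoiding_arc lamL pE gY.1.
(* Just after v the intervals X and Y meet, so they are equal by disjointness, although X omits its
   own end v. *)
have [z [Xz Yz]] : exists z, X z /\ Y z.
  rewrite E E' in Yv *.
  have [uu'|uu'] := pselect (ccw p u u').
    have [z hz] := arc_nonempty (u := v) (v := u) ltac:(clear -vu; circ p).
    by exists z; split=> //; clear -vu vu' Yv uu' hz; circ v.
  have [z hz] := arc_nonempty (u := v) (v := u') ltac:(clear -vu vu' Yv; circ p).
  by exists z; clear -vu vu' Yv uu' hz; circ v.
have XY : X = Y by case: gapG => _ tr _; apply: tr => //; exists z.
by move: Yv; rewrite -XY E => /ccw_neq[].
Qed.

End Rainbow.

(** * Limits of leaves under iteration *)

Section ArcUnions.
Context {R : realType}.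
Implicit Types (c d q s u v x y z : S1 R) (a b : nat -> S1 R).

Lemma bigcup_arc_right c s b : (forall n, ccw c (b n) s) ->
  (forall y, ccw c y s -> exists n, ccw c y (b n)) ->
  \bigcup_n arc c (b n) = arc c s.
Proof.
move=> bs sb; apply/seteqP; split=> y; last by move=> /sb[n h]; exists n.
by move=> [n _ /= h]; have := bs n; circ c.
Qed.

Lemma line_nonincreasing c a n m : (forall n, a n <> c) ->
  (forall n, ~ ccw c (a n) (a n.+1)) -> (n <= m)%N -> ~ ccw c (a n) (a m).
Proof.
move=> ac step /subnK<-; elim: (m - n)%N => [|k ih]; first by circ c.
have := ac n; have := ac (k + n)%N; have := ac (k + n).+1; have := step (k + n)%N.
by rewrite addSn; circ c.
Qed.

Lemma line_nondecreasing c b n m : (forall n, b n <> c) ->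
  (forall n, ~ ccw c (b n.+1) (b n)) -> (n <= m)%N -> ~ ccw c (b m) (b n).
Proof.
move=> bc step /subnK<-; elim: (m - n)%N => [|k ih]; first by circ c.
have := bc n; have := bc (k + n)%N; have := bc (k + n).+1; have := step (k + n)%N.
by rewrite addSn; circ c.
Qed.

(** On the line S1 \ c the left ends run down to c, in the role of minus infinity, and the right
    ends rise to s; by monotonicity the larger of two indices serves both ends. *)
Lemma bigcup_arc_inner c s a b : (forall n, ccw c (a n) (b n)) ->
  (forall n, ~ ccw c (a n) (a n.+1)) ->
  (forall n, ~ ccw c (b n.+1) (b n)) ->
  (forall n, ~ ccw c s (b n)) -> s <> c ->
  (forall y, y <> c -> exists n, ccw c (a n) y) ->
  (forall y, ccw c y s -> exists n, ccw c y (b n)) ->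
  \bigcup_n arc (a n) (b n) = arc c s.
Proof.
move=> ab astep bstep bs sc ha hb; apply/seteqP; split=> y.
  move=> [n _ /= h]; have yc : y <> c by move=> yc; have := ab n; circ c.
  by have := ab n; have := bs n; circ c.
move=> ys; have [n hn] := ha y ltac:(circ c); have [m hm] := hb y ys.
exists (maxn n m) => //=.
have an k : a k <> c by have := ab k; circ c.
have bn k : b k <> c by have := ab k; circ c.
have := line_nonincreasing an astep (leq_maxl n m).
have := line_nondecreasing bn bstep (leq_maxr n m).
by have := ab (maxn n m); circ c.
Qed.

(** These arcs contain c: they are the complements of the segments [b n, a n] of the line S1 \ c,
    whose intersection is [d, s]. *)
Lemma bigcup_arc_outer c d s a b : (forall n, ccw c s (a n)) ->
  (forall n, ccw c (b n) d) -> ccw c d s ->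
  (forall y, ccw c s y -> exists n, ccw c (a n) y) ->
  (forall y, ccw c y d -> exists n, ccw c y (b n)) ->
  \bigcup_n arc (a n) (b n) = arc s d.
Proof.
move=> sa bd ds ha hb; have := sa 0%N; have := bd 0%N => b0 a0.
apply/seteqP; split=> y.
  move=> [n _ /= h]; have := sa n; have := bd n.
  by have [->|yc] := pselect (y = c); circ c.
move=> h; have [->|yc] := pselect (y = c); first by exists 0%N => //=; circ c.
have [h1|h1] := pselect (ccw c s y).
  have [n hn] := ha _ h1; exists n => //=.
  by have := sa n; have := bd n; circ c.
have [|n hn] := hb y; first by circ c.
exists n => //=.
by have := sa n; have := bd n; circ c.
Qed.

Lemma sub_arc_outer c u v u' v' : ccw c v u -> ccw c v' u' ->
  ~ ccw c v' v -> ~ ccw c u u' -> arc u v `<=` arc u' v'.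
Proof.
move=> h1 h2 h3 h4 y h; have [->|yc] := pselect (y = c); first by circ c.
by circ c.
Qed.

End ArcUnions.

Section Dynamics.
Context {R : realType}.
Implicit Types (a b c d e p q u v w x y z s : S1 R) (g h : S1 R -> S1 R).
Implicit Types (L : set (set (S1 R))).

Definition arc_invariant L g := forall u v, L (arc u v) -> L (arc (g u) (g v)).

Lemma iter_arc_invariant L g n : arc_invariant L g -> arc_invariant L (iter n g).
Proof. by move=> Lg; elim: n => // n ih u v /ih/Lg. Qed.

Lemma limit_arc L (a b : nat -> S1 R) u v : lamination_system L ->
  (forall n, L (arc (a n) (b n))) ->
  (forall n, arc (a n) (b n) `<=` arc (a n.+1) (b n.+1)) ->
  \bigcup_n arc (a n) (b n) = arc u v -> u <> v -> L (arc u v).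
Proof.
move=> [_ _ _ lim] Lab mono E uv; rewrite -E; apply: lim => //.
by rewrite E; exists u, v.
Qed.

(** If g moved v down while moving x up, [fixed_between] would give a fixed point separating them;
    it is applied to [g'] when v lies below x. *)
Lemma same_direction g g' p x v : circle_auto g g' -> g p = p ->
  ccw p x (g x) -> v <> p -> g v <> v ->
  (forall s, g s = s -> ~ (ccw p x s /\ ccw p s v)) ->
  (forall s, g s = s -> ~ (ccw p v s /\ ccw p s x)) -> ccw p v (g v).
Proof.
move=> gg' gp xgx vp gv F1 F2; apply: contrapT => n.
have gvp : g v <> p by rewrite -gp => /(auto_inj gg').
have gvv : ccw p (g v) v by circ p.
have [h|h] := pselect (ccw p x v).
  by have [s [/F1 gs ? ?]] := fixed_between gg' gp h xgx gvv; apply: gs.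
have vx : ccw p v x by have xv : x <> v by [move=> xv; subst]; circ p.
have g'p : g' p = p by apply/(auto_fix _ gg').
have [gK g'K _ _] := gg'.
have [||s [/(auto_fix _ gg')/F2 gs ? ?]] :=
    fixed_between (circle_auto_sym gg') g'p vx; last by apply: gs.
  by apply/(auto_ccw_fix _ _ gg' gp); rewrite g'K.
by apply/(auto_ccw_fix _ _ gg' gp); rewrite g'K.
Qed.

(** The orbit of q increases to a fixed point in (c, d], which can only be d, so the images of (c,
    q) exhaust (c, d). *)
Lemma push_arc_up L g g' c d q : lamination_system L -> circle_auto g g' ->
  arc_invariant L g -> g c = c -> g d = d -> ccw c q d -> L (arc c q) ->
  (forall y, ccw c y d -> g y <> y) -> ccw c q (g q) -> L (arc c d).
Proof.
move=> lamL gg' Lg gc gd qd Lq nofix up.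
have below n : ccw c (iter n g q) d.
  rewrite -(iter_fix n gd); apply/(auto_ccw_fix _ _ (iter_auto n gg')) => //.
  exact: iter_fix.
have [|n|s [gs ds qs ss cof]] := @orbit_sup _ g g' c gg' gc q d up.
- by circ c.
- by have := below n; circ c.
have sd : s = d.
  by apply: contrapT => sd; apply: (nofix s); circ c.
subst s; apply: (@limit_arc L (fun=> c) (fun n => iter n g q)) => //.
- by move=> n; have := iter_arc_invariant n Lg Lq; rewrite iter_fix.
- by move=> n y /= h; have := orbit_up gg' gc n up; rewrite /= in h *; circ c.
- exact: bigcup_arc_right.
- by circ c.
Qed.

Lemma push_arc L g g' c d q : lamination_system L -> circle_auto g g' ->
  arc_invariant L g -> arc_invariant L g' ->
  g c = c -> g d = d -> ccw c q d -> L (arc c q) ->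
  (forall y, ccw c y d -> g y <> y) -> L (arc c d).
Proof.
move=> lamL gg' Lg Lg' gc gd qd Lq nofix.
have gq := nofix _ qd; have [gK g'K _ _] := gg'.
have gqc : g q <> c by rewrite -gc => /(auto_inj gg') ?; circ c.
have [up|up] := pselect (ccw c q (g q)); first exact: (push_arc_up lamL gg' Lg _ _ qd).
apply: (push_arc_up lamL (circle_auto_sym gg') Lg' _ _ qd) => //.
- exact/(auto_fix _ gg').
- exact/(auto_fix _ gg').
- by move=> y /nofix gy /(auto_fix _ gg').
- by apply/(auto_ccw_fix _ _ gg' gc); rewrite g'K; circ c.
Qed.

(** Since h moves all other points in one direction, a rainbow interval (v, u) with v < y and h y <
    u would satisfy v < h v < u < h u and be linked with its image. *)
Lemma cusp_endpoint L h h' c y : lamination_system L -> very_full L ->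
  circle_auto h h' -> arc_invariant L h -> h c = c ->
  (forall x, h x = x -> x = c) -> ccw c y (h y) -> endpoints L c.
Proof.
move=> lamL vfL hh' Lh hc uniq yhy; apply: contrapT => cE.
have [v [u [Lvu vy hyu]]] := rainbow lamL vfL cE yhy.
have up w : w <> c -> ccw c w (h w).
  move=> wc; apply: (same_direction hh' hc yhy wc) => [/uniq //|s /uniq->|s /uniq->].
    by move=> [/ccw_neq[]].
  by move=> [/ccw_neq[]].
have vhv : ccw c v (h v) by apply: up; circ c.
have uhu : ccw c u (h u) by apply: up; circ c.
have hvhy : ccw c (h v) (h y) by apply/(auto_ccw_fix _ _ hh' hc).
by apply: (unlinked lamL Lvu (Lh _ _ Lvu)); circ c.
Qed.

Lemma endpoint_leaf L c : lamination_system L -> endpoints L c ->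
  exists2 q, q <> c & L (arc c q).
Proof.
move=> lamL [I LI Ic]; have [u [v [uv E]]] := lamination_arc lamL LI.
rewrite E in LI Ic; have LI' := lamination_dual lamL LI uv.
have [cu|cu] := pselect (c = u); first by subst c; exists v => //; exact: nesym.
have [cv|cv] := pselect (c = v); first by subst c; exists u.
exfalso; apply: Ic; have [h|h] := ccw_total (nesym cu) cv uv.
  by exists (arc u v) => //; left.
by exists (arc v u); [right; rewrite dual_arc|circ c].
Qed.

(** Some leaf (c, q) ends at c. The orbit of d is unbounded and passes q, so an inverse iterate
    carries q below d. *)
Lemma cusp_arc_up L h h' c d y : lamination_system L -> very_full L ->
  circle_auto h h' -> arc_invariant L h -> arc_invariant L h' -> h c = c ->
  (forall x, h x = x -> x = c) -> ccw c y (h y) -> d <> c ->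
  exists q, ccw c q d /\ L (arc c q).
Proof.
move=> lamL vfL hh' Lh Lh' hc uniq yhy dc.
have [q qc Lq] := endpoint_leaf lamL (cusp_endpoint lamL vfL hh' Lh hc uniq yhy).
have dhd : ccw c d (h d).
  apply: (same_direction hh' hc yhy dc) => [/uniq //|s /uniq->|s /uniq->].
    by move=> [/ccw_neq[]].
  by move=> [/ccw_neq[]].
have [n hn] : exists n, ccw c q (iter n h d).
  by apply: (orbit_unbounded hh' hc dhd qc) => x /uniq-> /ccw_neq[].
have hh'n := iter_auto n hh'; have [hK h'K _ _] := hh'n.
exists (iter n h' q); split.
  by apply/(auto_ccw_fix _ _ hh'n (iter_fix n hc)); rewrite h'K.
have := iter_arc_invariant n Lh' Lq; rewrite (iter_fix n) //.
exact/(auto_fix _ hh').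
Qed.

Lemma cusp_arc L h h' c d : lamination_system L -> very_full L ->
  circle_auto h h' -> arc_invariant L h -> arc_invariant L h' -> h c = c ->
  (forall x, h x = x -> x = c) -> d <> c -> exists q, ccw c q d /\ L (arc c q).
Proof.
move=> lamL vfL hh' Lh Lh' hc uniq dc.
have hd : h d <> d by move=> /uniq.
have hdc : h d <> c by rewrite -hc => /(auto_inj hh').
have [dhd|dhd] := pselect (ccw c d (h d)); first exact: (cusp_arc_up _ _ hh' _ _ _ _ dhd).
apply: (cusp_arc_up _ _ (circle_auto_sym hh') _ _ (y := d)) => //.
- exact/(auto_fix _ hh').
- by move=> x /(auto_fix _ hh')/uniq.
apply/(auto_ccw_fix _ _ hh' hc); have [_ h'K _ _] := hh'; rewrite h'K.
by circ c.
Qed.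

End Dynamics.

(** * Rainbows at fixed points and fixed-point-free arcs *)

Section FixedPoints.
Context {R : realType}.
Implicit Types (a b c d e p q u v w x y z s : S1 R) (g h : S1 R -> S1 R).
Implicit Types (L : set (set (S1 R))).

Lemma iter_ccwV g g' c n x y : circle_auto g g' -> g c = c ->
  ccw c (iter n g' x) y <-> ccw c x (iter n g y).
Proof.
move=> gg' gc; have [_ h'K _ _] := iter_auto n gg'.
by rewrite -(auto_ccw_fix _ y (iter_auto n gg') (iter_fix n gc)) h'K.
Qed.

Lemma ccw_iter g g' c n x y : circle_auto g g' -> g c = c ->
  ccw c (iter n g x) (iter n g y) <-> ccw c x y.
Proof. by move=> gg' gc; exact: auto_ccw_fix (iter_auto n gg') (iter_fix n gc). Qed.

(* If c is not an endpoint, pulling back a rainbow interval around c by g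
   shrinks it to c on both sides, and pushing it forward expands it up to the
   neighbouring fixed points of g. *)
Lemma rainbow_fixed_up L g g' c d e x : lamination_system L -> very_full L ->
  circle_auto g g' -> arc_invariant L g -> arc_invariant L g' ->
  g c = c -> g d = d -> g e = e -> ~ endpoints L c -> ccw c d e ->
  (forall y, ccw c y d -> g y <> y) -> ccw c x d -> ccw c x (g x) ->
  exists s, [/\ g s = s, s <> c, forall y, g y = y -> y <> c -> ~ ccw c s y &
    L (arc s d)].
Proof.
move=> lamL vfL gg' Lg Lg' gc gd ge cE de nofix xd xgx.
have [v [u [Lvu vd eu]]] := rainbow lamL vfL cE de.
have g'g := circle_auto_sym gg'; have [gK g'K _ _] := gg'.
have g'c : g' c = c by apply/(auto_fix _ gg').
have up y : ccw c y d -> ccw c y (g y).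
  move=> yd; apply: (same_direction gg' gc xgx) => [||s gs|s gs].
  - by circ c.
  - exact: nofix.
  - by move=> [h1 h2]; apply: (nofix s) => //; circ c.
  - by move=> [h1 h2]; apply: (nofix s) => //; circ c.
have below y n : ccw c y d -> ccw c (iter n g y) d.
  by move=> yd; rewrite -(iter_fix n gd); apply/(ccw_iter _ _ _ gg').
have cofinal y z : ccw c y d -> ccw c z d -> exists n, ccw c z (iter n g y).
  move=> yd zd.
  have [|n|s [gs ds ys ss cof]] := orbit_sup gg' gc (up _ yd) (b := d).
  - by circ c.
  - by have := below _ n yd; circ c.
  apply: cof; have sd : s = d.
    by apply: contrapT => sd; apply: (nofix s) => //; clear -ds ys sd yd; circ c.
  by rewrite sd.
have vu : ccw c v u by clear -vd eu de; circ c.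
have uc : u <> c by clear -eu; circ c.
have vc : v <> c by clear -vd; circ c.
have guc : g u <> c by rewrite -gc => /(auto_inj gg').
(* Otherwise v < g v < u < g u, and the leaf is linked with its image. *)
have down : ~ ccw c u (g u).
  move=> ugu; apply: (unlinked lamL Lvu (Lg _ _ Lvu)).
    by have := up _ vd; have := below v 1%N vd; rewrite /=; clear -vd eu de; circ c.
  by have := up _ vd; clear -vu ugu; circ c.
have Lback n : L (arc (iter n g' v) (iter n g' u)) by exact: iter_arc_invariant.
have vstep n : ~ ccw c (iter n g' v) (iter n.+1 g' v).
  rewrite iterSr (ccw_iter _ _ _ g'g) // -(auto_ccw_fix _ _ gg' gc) g'K.
  by have := up _ vd; circ c.
have ustep n : ~ ccw c (iter n.+1 g' u) (iter n g' u).
  by rewrite iterSr (ccw_iter _ _ _ g'g) // -(auto_ccw_fix _ _ gg' gc) g'K.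
have back n : ccw c (iter n g' v) (iter n g' u) by rewrite (ccw_iter _ _ _ g'g).
(* If the backward orbit of u converged to s, the backward images of (v, u) would exhaust (c, s),
   making c an endpoint. This excludes that g fixes u or any point above u. *)
have noback s : s <> c -> (forall n, ~ ccw c s (iter n g' u)) ->
    (forall y, ccw c y s -> exists n, ccw c y (iter n g' u)) -> False.
  move=> sc us su; apply: cE; apply: (endpoint_arc lamL _).1.
  apply: (@limit_arc _ L (fun n => iter n g' v) (fun n => iter n g' u) c s) => //.
  - by move=> n; exact: (sub_arc (back n) (back n.+1) (vstep n) (ustep n)).
  - apply: bigcup_arc_inner => // y yc.
    have [h|h] := pselect (ccw c y d); last by exists 0%N => /=; clear -vd h yc; circ c.
    by have [n] := cofinal _ _ h vd; exists n; apply/(iter_ccwV _ _ _ gg').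
  - exact: nesym.
have gu : ccw c (g u) u.
  suff : g u <> u by clear -down uc guc; circ c.
  move=> gu; have g'u : g' u = u by apply/(auto_fix _ gg').
  apply: (noback u uc) => [n|y yu]; first by rewrite iter_fix //; circ c.
  by exists 0%N.
have g'u : ccw c u (g' u) by apply/(auto_ccw_fix _ _ gg' gc); rewrite g'K.
have nofix_above y : g y = y -> ~ ccw c u y.
  move=> gy uy; have g'y : g' y = y by apply/(auto_fix _ gg').
  have lt n : ccw c (iter n g' u) y.
    by rewrite -(iter_fix n g'y) (ccw_iter _ _ _ g'g).
  have [|n|s [gs ys us su cof]] := orbit_sup g'g g'c g'u (b := y).
  - by clear -uy; circ c.
  - by have := lt n; circ c.
  apply: (noback s) => // [|n]; first by clear -us; circ c.
  by have := su n; circ c.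
(* The greatest fixed point not above u is the greatest of all by [nofix_above]: it is the fixed
   point preceding c on the circle. *)
have [|s [gs sc us smax]] := sup_of_fixed_points gg' gc uc.
  by exists e => //; clear -eu; circ c.
have top y : g y = y -> y <> c -> ~ ccw c s y.
  move=> gy yc; apply: smax => //; exact: nofix_above.
have ds : ccw c d s by have := top _ ge ltac:(clear -eu; circ c); clear -de sc; circ c.
have su : ccw c s u.
  have : s <> u by move=> su; rewrite -su gs in gu; circ c.
  by clear -us sc uc; circ c.
exists s; split=> //.
(* Under forward iteration u descends to s and v rises to d, so the images of the dual interval (u,
   v) exhaust (s, d). *)
apply: (@limit_arc _ L (fun n => iter n g u) (fun n => iter n g v) s d) => //.
- move=> n; apply: (lamination_dual lamL); first exact: iter_arc_invariant.
  by have /ccw_neq[] : ccw c (iter n g v) (iter n g u) by rewrite (ccw_iter _ _ _ gg').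
- move=> n; apply: (@sub_arc_outer _ c); rewrite ?iterSr ?(ccw_iter _ _ _ gg') //.
  + by apply/(auto_ccw_fix _ _ gg' gc).
  + by have := up _ vd; clear; circ c.
- apply: (@bigcup_arc_outer _ c) => // [n|n|y sy|y yd].
  + by rewrite -(iter_fix n gs) (ccw_iter _ _ _ gg').
  + exact: below.
  + have yc : y <> c by clear -sy; circ c.
    have nofixs w z : ccw c s w -> forall t, g' t = t -> ~ (ccw c w t /\ ccw c t z).
      move=> sw t /(auto_fix _ gg') gt [wt tz]; apply: (top t gt).
        by clear -wt; circ c.
      by clear -sw wt; circ c.
    have yg'y : ccw c y (g' y).
      apply: (same_direction g'g g'c g'u yc); [|exact: nofixs..].
      by move=> /(auto_fix _ gg') gy; apply: (top y).
    have [n hn] : exists n, ccw c u (iter n g' y).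
      apply: (orbit_unbounded g'g g'c yg'y uc) => t /(auto_fix _ gg') gt yt.
      by apply: (top t) => //; clear -yt sy; circ c.
    by exists n; apply/(iter_ccwV _ _ _ g'g).
  + exact: cofinal.
- by clear -ds; circ c.
Qed.

Lemma rainbow_fixed L g g' c d e x : lamination_system L -> very_full L ->
  circle_auto g g' -> arc_invariant L g -> arc_invariant L g' ->
  g c = c -> g d = d -> g e = e -> ~ endpoints L c -> ccw c d e ->
  (forall y, ccw c y d -> g y <> y) -> ccw c x d ->
  exists s, [/\ g s = s, s <> c, forall y, g y = y -> y <> c -> ~ ccw c s y &
    L (arc s d)].
Proof.
move=> lamL vfL gg' Lg Lg' gc gd ge cE de nofix xd.
have [xgx|nx] := pselect (ccw c x (g x)).
  exact: (rainbow_fixed_up lamL vfL gg' Lg Lg' gc gd ge cE de nofix xd).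
have [_ g'K _ _] := gg'.
have gxc : g x <> c by rewrite -gc => /(auto_inj gg') xc; circ c.
have gx := nofix _ xd.
have [|||y /nofix gy /(auto_fix _ gg')//||s [gs sc top Ls]] :=
  rainbow_fixed_up lamL vfL (circle_auto_sym gg') Lg' Lg _ _ _ cE de _ xd.
- exact/(auto_fix _ gg').
- exact/(auto_fix _ gg').
- exact/(auto_fix _ gg').
- by apply/(auto_ccw_fix _ _ gg' gc); rewrite g'K; circ c.
exists s; split=> //; first exact/(auto_fix _ gg').
by move=> y /(auto_fix _ gg'); exact: top.
Qed.

(** The component of x in the complement of the fixed points: if g moves x up, c is the last fixed
    point before x and d is the limit of the orbit of x; otherwise g is replaced by its inverse. *)
Lemma fixed_free_arc g g' a b e x : circle_auto g g' ->
  g a = a -> g b = b -> g e = e -> ccw e a x -> ccw e x b -> g x <> x ->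
  exists c d, [/\ g c = c, g d = d, ccw e c x, ccw e x d &
    forall y, ccw e c y -> ccw e y d -> g y <> y].
Proof.
move=> gg' ga gb ge ax xb gx.
wlog xgx : g g' gg' ga gb ge gx / ccw e x (g x).
  move=> H; have [h|h] := pselect (ccw e x (g x)); first exact: (H g g').
  have [_ g'K _ _] := gg'.
  have gxe : g x <> e by rewrite -ge => /(auto_inj gg') xe; circ e.
  have [|||||c [d [gc gd cx xd F]]] := H _ _ (circle_auto_sym gg').
  - exact/(auto_fix _ gg').
  - exact/(auto_fix _ gg').
  - exact/(auto_fix _ gg').
  - by move=> /(auto_fix _ gg').
  - by apply/(auto_ccw_fix _ _ gg' ge); rewrite g'K; circ e.
  exists c, d; split=> //; try exact/(auto_fix _ gg').
  by move=> y cy yd /(auto_fix _ gg'); exact: F.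
have xe : x <> e by circ e.
have [|c [gc ce xc cmax]] := sup_of_fixed_points gg' ge xe.
  by exists a => //; split; circ e.
have [|n|d [gd bd xd dn cof]] := orbit_sup gg' ge xgx (b := b).
- by circ e.
- have : ccw e (iter n g x) b by rewrite -(iter_fix n gb) (ccw_iter _ _ _ gg').
  by circ e.
have cx : ccw e c x.
  by have : c <> x by [move=> cx; rewrite cx in gc]; circ e.
exists c, d; split=> // y cy yd gy.
have [xy|xy] := pselect (ccw e x y).
  have [n hn] := cof _ yd.
  have : ccw e (iter n g x) y by rewrite -(iter_fix n gy) (ccw_iter _ _ _ gg').
  by circ e.
have := cmax _ gy; have ye : y <> e by circ e.
by move=> /(_ ye xy).
Qed.

End FixedPoints.

(** * Elements moving a leaf slightly *)

Section LeafFixed.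
Context {R : realType}.
Implicit Types (a b c d e p q u v w x y z s m : S1 R) (g h k : S1 R -> S1 R).
Implicit Types (L : set (set (S1 R))).

(** An end of (a, b) outside the closed arc [u, v] would have points of (a, b) near it outside as
    well. *)
Lemma sub_arc_ends a b u v : a <> b -> u <> v -> arc a b `<=` arc u v ->
  ~ arc v u a /\ ~ arc v u b.
Proof.
move=> ab uv sub; split=> h.
  have [h1|h1] := pselect (ccw a u b).
    have [z hz] := arc_nonempty (u := a) (v := u) ltac:(circ a).
    by have /sub : arc a b z; circ a.
  have [z hz] := arc_nonempty ab; have := sub z hz.
  by have [?|?] := pselect (u = b); circ a.
have [h1|h1] := pselect (ccw a v b).
  have [z hz] := arc_nonempty (u := v) (v := b) ltac:(circ b).
  by have /sub : arc a b z; circ b.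
have [z hz] := arc_nonempty ab; have := sub z hz.
by have [?|?] := pselect (v = a); circ b.
Qed.

(* Knaster-Tarski on the closed arc [u, v], ordered as a segment of the line
   S1 \ m. *)
Lemma arc_self_map_fixed k u v m : orientation_preserving k -> u <> v ->
  k u <> k v -> arc (k u) (k v) `<=` arc u v -> arc v u m -> arc v u (k m) ->
  exists z, k z = z /\ ~ arc v u z.
Proof.
move=> ok uv kuv sub hm hkm.
have [ku kv] := sub_arc_ends kuv uv sub.
have muv : ccw m u v by circ m.
have into x : ~ arc v u x -> ~ arc v u (k x).
  move=> hx; have [->//|xu] := pselect (x = u).
  have [->//|xv] := pselect (x = v).
  have /ok/sub : ccw u x v by clear -hx xu xv uv; circ u.
  by clear; circ u.
have nm x : ~ arc v u x -> x <> m by move=> hx xm; rewrite xm in hx.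
(* Both m and [k m] lie in the complementary arc, so they induce the same order on [u, v]. *)
have mono x y : ~ arc v u x -> ~ arc v u y -> ccw m x y -> ccw m (k x) (k y).
  move=> hx hy /ok; have := into _ hx; have := into _ hy.
  have := nm _ (into _ hx); have := nm _ (into _ hy).
  have [->//|kmm] := pselect (k m = m).
  by clear -kmm hkm muv; circ m.
(* The points with x <= k x; their supremum is fixed. *)
pose A := [set x | ~ arc v u x /\ ~ ccw m (k x) x].
have vm : v <> m by clear -muv; circ m.
have um : u <> m by clear -muv; circ m.
have huu : ~ arc v u u by move=> /ccw_neq[].
have Au : A u.
  by split=> //; have := into _ huu; have := nm _ (into _ huu); clear -muv; circ m.
have [|x [hx _]|s [sm sub' slub]] := @line_sup _ m A v _ vm.
- by exists u.
- by split; [exact: nm | have := nm _ hx; clear -muv hx; circ m].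
have su := sub' _ Au.
have vs : ~ ccw m v s.
  by move=> /slub[x [hx _]]; have := nm _ hx; clear -muv hx; circ m.
have hs : ~ arc v u s by clear -muv sm su vs; circ m.
have hks := into _ hs; have ksm := nm _ hks.
exists s; split=> //; apply: contrapT => ne.
have [h|h] := ccw_total (nesym ksm) ne (nesym sm).
  have [x [hx kx] h'] := slub _ h; have xs := sub' _ (conj hx kx).
  have xm := nm _ hx; have kxm := nm _ (into _ hx).
  have [xs'|xs'] := pselect (x = s); first by rewrite xs' in kx.
  have : ccw m x s by clear -xs xs' xm sm; circ m.
  by move=> /(mono _ _ hx hs); clear -kx h' xm kxm; circ m.
apply: (sub' (k s)) (h); split=> //.
by have := mono _ _ hs hks h; clear; circ m.
Qed.

(** Of the four inclusions between the leaf and its image, the points a and b refute the two that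
    exchange sides. In the other two, g or its inverse maps the arc into itself. *)
Lemma near_identity_fixed L g g' u v a b : lamination_system L ->
  circle_auto g g' -> arc_invariant L g -> L (arc u v) ->
  arc u v a -> arc u v (g a) -> arc v u b -> arc v u (g b) ->
  exists z, g z = z /\ ~ arc v u z.
Proof.
move=> lamL gg' Lg Luv ha hga hb hgb.
have [gK g'K og og'] := gg'.
have uv := lamination_neq lamL Luv; have Lguv := Lg _ _ Luv.
have guv := lamination_neq lamL Lguv.
case: (lamL) => _ _ h _; have := h _ _ Lguv Luv; rewrite /leaf_lies_on !dual_arc //.
move=> [[]|[]] sub.
- exact: (arc_self_map_fixed og uv guv sub hb hgb).
- by have /sub : arc (g v) (g u) (g b) by [apply: og]; circ u.
- by have /sub : arc (g u) (g v) (g a) by [apply: og]; circ u.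
have [gv gu] := sub_arc_ends (nesym guv) (nesym uv) sub.
have g'uv : g' u <> g' v by move=> /(auto_inj (circle_auto_sym gg')).
have sub' : arc (g' u) (g' v) `<=` arc u v.
  move=> y /og; rewrite !g'K => hy; apply: contrapT => nuv.
  have [yu|yu] := pselect (y = u); first by rewrite yu in hy.
  have [yv|yv] := pselect (y = v); first by rewrite yv in hy.
  have /og/sub : ccw v y u by clear -nuv yu yv uv; circ u.
  by move: hy; clear; circ u.
have [|z [gz hz]] := arc_self_map_fixed og' uv g'uv sub' hgb; first by rewrite gK.
by exists z; split=> //; apply/(auto_fix _ gg').
Qed.

End LeafFixed.

(** * Pants-like groups *)

Section PantsLike.
Context {R : realType}.
Implicit Types (a b c d e p q u v w x y z s : S1 R) (g h : S1 R -> S1 R).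
Variables (G : set (S1 R -> S1 R)) (L : 'I_3 -> set (set (S1 R))).
Hypotheses (groupG : subgroup_HomeoP G) (pantsL : pants_like_collection G L).

Lemma group_auto g : G g -> exists2 g', G g' & circle_auto g g'.
Proof.
move=> Gg; have [GH _ _ inv] := groupG; have [g' [Gg' gK g'K]] := inv _ Gg.
by exists g' => //; split=> //; [have [] := GH _ Gg|have [] := GH _ Gg'].
Qed.

Lemma group_arc_invariant g i : G g -> arc_invariant (L i) g.
Proof.
move=> Gg u v Luv; have [g' _ gg'] := group_auto Gg.
have [Li _ _] := pantsL; have [_ inv _] := Li i.
by rewrite -(auto_arc _ _ gg'); exact: inv.
Qed.

Lemma pants_lamination i : lamination_system (L i).
Proof. by have [h _ _] := pantsL; have [] := h i. Qed.

Lemma pants_very_full i : very_full (L i).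
Proof. by have [h _ _] := pantsL; have [] := h i. Qed.

Lemma pants_transverse i j I : i <> j -> L i I -> L j I -> False.
Proof.
by have [_ h _] := pantsL => /h + Li Lj; rewrite /transverse => /seteqP[/(_ I) + _]; apply.
Qed.

Lemma pants_cusp i j c : i <> j -> endpoints (L i) c -> endpoints (L j) c ->
  cusp_point G c.
Proof. by have [_ _ h] := pantsL => /h + Ei Ej; apply. Qed.

Lemma cusp_small_arc i c d : cusp_point G c -> d <> c ->
  exists q, ccw c q d /\ L i (arc c q).
Proof.
move=> [h [Gh [_ _ [x hx]] hc]]; have [h' Gh' hh'] := group_auto Gh.
apply: (cusp_arc (pants_lamination i) (@pants_very_full i) hh') => //;
  try exact: group_arc_invariant.
have xc : c = x by have : [set y | h y = y] c by []; rewrite hx.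
by move=> y hy; have : [set y | h y = y] y by []; rewrite hx xc.
Qed.

(** An endpoint of two systems is a cusp point, with short intervals (x, q); otherwise one of the
    two has a rainbow at x. The conclusion controls the closed arc [u, v], where fixed points will
    be found. *)
Lemma small_arc x a b : arc a b x ->
  exists i u v, L i (arc u v) /\ forall z, ~ arc v u z -> arc a b z.
Proof.
move=> axb; pose i : 'I_3 := ord0; pose j : 'I_3 := ord_max.
have rainbow_arc k : ~ endpoints (L k) x ->
    exists i u v, L i (arc u v) /\ forall z, ~ arc v u z -> arc a b z.
  move=> xE; have xba : ccw x b a by circ x.
  have [v [u [Lvu vb au]]] :=
    rainbow (pants_lamination k) (@pants_very_full k) xE xba.
  exists k, u, v; split.
    by apply: (lamination_dual (pants_lamination k) Lvu); clear -vb au xba; circ x.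
  move=> z; have [->//|zx] := pselect (z = x).
  by clear -zx vb au xba; circ x.
have [xi|/rainbow_arc//] := pselect (endpoints (L i) x).
have [xj|/rainbow_arc//] := pselect (endpoints (L j) x).
have ij : i <> j by [].
have bx : b <> x by circ x.
have [q [xq Lq]] := cusp_small_arc i (pants_cusp ij xi xj) bx.
exists i, x, q; split=> // z.
have [->//|zx] := pselect (z = x).
by clear -zx xq axb; circ x.
Qed.

Lemma three_fixed_points g a b e : G g -> g a = a -> g b = b -> g e = e ->
  ccw a b e -> forall x, g x = x.
Proof.
move=> Gg.
have main u v w x : g u = u -> g v = v -> g w = w -> ccw w u x -> ccw w x v ->
    g x <> x -> False.
  move=> gu gv gw ux xv gx; have [g' Gg' gg'] := group_auto Gg.
  have [c [d [gc gd cx xd F]]] := fixed_free_arc gg' gu gv gw ux xv gx.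
  have nofix y : ccw c y d -> g y <> y.
    have [->|yw] := pselect (y = w); first by clear -cx xd; circ w.
    by move=> h; apply: F; clear -yw h cx xd; circ w.
  have cdw : ccw c d w by clear -cx xd; circ w.
  have cxd : ccw c x d by clear -cx xd; circ w.
  have inv i : arc_invariant (L i) g by exact: group_arc_invariant.
  have inv' i : arc_invariant (L i) g' by exact: group_arc_invariant.
  have ncusp : ~ cusp_point G c.
    move=> cusp; have Lcd i : L i (arc c d).
      have [|q [qd Lq]] := cusp_small_arc i cusp (d := d); first by clear -cdw; circ c.
      exact: (push_arc (pants_lamination i) gg' (inv i) (inv' i) gc gd qd Lq nofix).
    exact: (@pants_transverse ord0 ord_max _ _ (Lcd _) (Lcd _)).
  (* Were c an endpoint of neither, both systems would contain (s, d) for the same s, the fixed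
     point preceding c. *)
  have two i j : i <> j -> endpoints (L i) c \/ endpoints (L j) c.
    move=> ij; apply: contrapT => /not_orP[ci cj].
    have lim k (ck : ~ endpoints (L k) c) := rainbow_fixed (pants_lamination k) (@pants_very_full k) gg'
      (inv k) (inv' k) gc gd gw ck cdw nofix cxd.
    have [s [gs sc smax Ls]] := lim i ci; have [t [gt tc tmax Lt]] := lim j cj.
    have st : s = t.
      by have := smax _ gt tc; have := tmax _ gs sc; clear -sc tc; circ c.
    by rewrite -st in Lt; exact: (pants_transverse ij Ls Lt).
  pose i0 : 'I_3 := @Ordinal 3 0 isT; pose i1 : 'I_3 := @Ordinal 3 1 isT.
  pose i2 : 'I_3 := @Ordinal 3 2 isT.
  have n01 : i0 <> i1 by [].
  have n12 : i1 <> i2 by [].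
  have n02 : i0 <> i2 by [].
  have P i j : i <> j -> endpoints (L i) c -> endpoints (L j) c -> False.
    by move=> ij ci cj; apply: ncusp; exact: (pants_cusp ij ci cj).
  (* By [two], c is an endpoint of at least two of the three systems; by [P], of at most one. *)
  have := P _ _ n01; have := P _ _ n12; have := P _ _ n02.
  have := two _ _ n01; have := two _ _ n12; have := two _ _ n02; tauto.
move=> ga gb ge abe x; apply: contrapT => gx.
have xa : x <> a by move=> xa; rewrite xa in gx.
have xb : x <> b by move=> xb; rewrite xb in gx.
have xe : x <> e by move=> xe; rewrite xe in gx.
have [h|h] := pselect (ccw a x b).
  by apply: (main a b e x) => //; clear -h abe; circ a.
have [h'|h'] := pselect (ccw b x e).
  by apply: (main b e a x) => //; clear -h' abe; circ b.
by apply: (main e a b x) => //; clear -h h' abe xa xb xe; circ a.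
Qed.

End PantsLike.

(** * The compact-open topology and isolation of group elements *)

Section Topology.
Context {R : realType}.
Implicit Types (u v x : S1 R).

Lemma xco_continuous : continuous (@xco R).
Proof.
have h : continuous (set_val : S1 R -> R * R) by exact: initial_continuous.
by move=> x; apply: continuous_comp; [exact: h|exact: cvg_fst].
Qed.

Lemma yco_continuous : continuous (@yco R).
Proof.
have h : continuous (set_val : S1 R -> R * R) by exact: initial_continuous.
by move=> x; apply: continuous_comp; [exact: h|exact: cvg_snd].
Qed.

Lemma arc_open u v : open (arc u v).
Proof.
pose f x := (xco x - xco u) * (yco v - yco u) - (yco x - yco u) * (xco v - xco u).
have -> : arc u v = f @^-1` [set r | 0 < r] by [].
have lin (r s : R) (k : S1 R -> R) : continuous k ->
    continuous (fun x => (k x - r) * s).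
  move=> ck x.
  exact: (cvgM (cvgB (ck x) (cvg_cst r)) (cvg_cst s)).
have cf : continuous f.
  move=> x; exact: (cvgB (lin _ _ _ xco_continuous x) (lin _ _ _ yco_continuous x)).
by apply: open_comp; [move=> x _; exact: cf|exact: open_gt].
Qed.

(** Singletons are compact, so this set is subbasic. *)
Lemma eval_open (U V : topologicalType) (x : U) (O : set V) : open O ->
  open ([set f | O (f x)] : set {compact-open, U -> V}).
Proof.
move=> oO; have := compact_open_open (@compact_set1 _ x) oO.
by congr open; apply/seteqP; split=> f /= h; [apply: h; exists x|move=> _ [_ -> <-]].
Qed.

End Topology.

Theorem corollary3p8 (R : realType) (G : set (S1 R -> S1 R)) :
  pants_like_COL 3 G -> subgroup_HomeoP G /\ discrete_in_compact_open G.
Proof.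
move=> [groupG [L pantsL]]; split=> // g Gg; split; first exact/mem_set.
have c0 : 0 < pi :> R by exact: pi_gt0.
(* Three points cut the circle into three disjoint arcs; each will contain a fixed point. *)
have [t0 [t1 [t2 t012]]] : exists t0 t1 t2 : S1 R, ccw t0 t1 t2.
  by exists (cis 0), (cis (0 + pi / 2)), (cis (0 + pi)); apply: ccw_angle; lra.
have [n01 n12 n02] := ccw_neq t012.
have [x0 hx0] := arc_nonempty n01.
have [x1 hx1] := arc_nonempty n12.
have [x2 hx2] := arc_nonempty (nesym n02).
have [g' Gg' gg'] := group_auto groupG Gg; have [gK g'K _ _] := gg'.
have [_ _ comp _] := groupG.
have nbhd x a b : arc a b x -> exists V : set {compact-open, S1 R -> S1 R},
    [/\ nbhs (g : {compact-open, S1 R -> S1 R}) V &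
     forall f, G f -> V f -> exists z, g' (f z) = z /\ arc a b z].
  move=> /(small_arc groupG pantsL)[i [u [v [Luv sub]]]].
  have lamL := pants_lamination pantsL i.
  have uv := lamination_neq lamL Luv.
  have [p hp] := arc_nonempty uv; have [q hq] := arc_nonempty (nesym uv).
  (* The conditions at the identity, translated by g: [g' \o f] keeps p in the arc and q in its
     dual. *)
  exists ([set f | arc (g u) (g v) (f p)] `&` [set f | arc (g v) (g u) (f q)]).
  split.
    apply: open_nbhs_nbhs; split.
      by apply: openI; exact/eval_open/arc_open.
    by split; apply/(auto_ccw _ _ _ gg').
  move=> f Gf [/= fp fq]; have Gh : G (g' \o f) by exact: comp.
  have [h' _ hh'] := group_auto groupG Gh.
  have gu w : ccw (g u) (f w) (g v) -> arc u v (g' (f w)).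
    by move=> h; apply/(auto_ccw _ _ _ gg'); rewrite g'K.
  have gv w : ccw (g v) (f w) (g u) -> arc v u (g' (f w)).
    by move=> h; apply/(auto_ccw _ _ _ gg'); rewrite g'K.
  have [z [hz zuv]] := near_identity_fixed lamL hh'
    (group_arc_invariant groupG pantsL Gh) Luv hp (gu _ fp) hq (gv _ fq).
  by exists z; split=> //; exact: sub.
have [V0 [N0 F0]] := nbhd _ _ _ hx0.
have [V1 [N1 F1]] := nbhd _ _ _ hx1.
have [V2 [N2 F2]] := nbhd _ _ _ hx2.
exists (V0 `&` V1 `&` V2); first exact: (filterI (filterI N0 N1) N2).
apply/seteqP; split=> [f [[[Vf0 Vf1] Vf2] Gf]|_ ->]; last first.
  split=> //; split; [split|].
  - exact: (nbhs_singleton N0).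
  - exact: (nbhs_singleton N1).
  - exact: (nbhs_singleton N2).
have [z0 [fz0 hz0]] := F0 _ Gf Vf0; have [z1 [fz1 hz1]] := F1 _ Gf Vf1.
have [z2 [fz2 hz2]] := F2 _ Gf Vf2.
have z1t0 : z1 <> t0 by clear -t012 hz1 => z1t0; circ t1.
have z012 : ccw z0 z1 z2 by clear -t012 hz0 hz1 hz2 z1t0; circ t0.
have Gh : G (g' \o f) by exact: comp.
(* Lying in successive arcs, the three fixed points of [g' \o f] are distinct and cyclically
   ordered, so this element is the identity and f = g. *)
have id := three_fixed_points groupG pantsL Gh fz0 fz1 fz2 z012.
by apply/funext => x; rewrite -[RHS](congr1 g (id x)) /= g'K.
Qed.
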